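(* Let $n\ge1$ and let $\lambda\vdash n$ and $\rho\vdash(n-1)$ be arbitrary Young diagrams. Then $$\sum_{\mu\vdash n:\ \mu\succ\rho} M(\mu,\lambda)=\sum_{\gamma\vdash (n-1):\ \gamma\prec\lambda}c(\lambda,\gamma)\,M(\rho,\gamma).$$
   Context: All representations are finite-dimensional and over $\mathbb C$; $\mathfrak S_n$ is the symmetric group on $\{1,\dots,n\}$ ($\mathfrak S_0$ is the trivial group, corresponding to the empty diagram). $\lambda\vdash n$ means a Young diagram with $n$ cells. $\gamma\prec\lambda$ (equivalently $\lambda\succ\gamma$) means that $\lambda$ is obtained from $\gamma$ by adding exactly one cell. For a diagram $\lambda\vdash n$, $H(\lambda)\subset\mathfrak S_n$ is the Young subgroup of permutations preserving each row of a fixed filling of $\lambda$ by $1,\dots,n$ (isomorphic to $\mathfrak S_{\lambda_1}\times\mathfrak S_{\lambda_2}\times\cdots$), and $\Pi_\lambda=\mathrm{Ind}_{H(\lambda)}^{\mathfrak S_n}\mathbf 1$ is the representation induced from its identity representation. For $\mu\vdash n$, $\pi_\mu$ is the irreducible representation of $\mathfrak S_n$ associated with $\mu$: it has a basis indexed by standard Young tableaux $T$ of shape $\mu$ on which each Jucys–Murphy element $X_i=(1\,i)+\dots+(i-1\,i)$ acts diagonally with eigenvalue the content (column index minus row index) of the cell containing $i$. This gives a bijection between diagrams with $n$ cells and classes of irreducible representations of $\mathfrak S_n$, and the restriction of $\pi_\mu$ to $\mathfrak S_{n-1}$ is the multiplicity-free sum of $\pi_\rho$ over $\rho\prec\mu$.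 $M(\mu,\lambda)$ denotes the multiplicity of $\pi_\mu$ in $\Pi_\lambda$ (and likewise $M(\rho,\gamma)$ for diagrams with $n-1$ cells and the group $\mathfrak S_{n-1}$). For $\gamma\prec\lambda$, the coefficient $c(\lambda,\gamma)$ is the number of rows (blocks) of the partition $\lambda$ such that decreasing that row by one element yields (after reordering) the partition $\gamma$; equivalently, the number of rows of $\lambda$ whose length equals the length in $\lambda$ of the row being modified in passing from $\lambda$ to $\gamma$. *)

(* Defs.v *)
(* Complex representations are taken over [algC]; multiplicities are the same
   as over the whole field of complex numbers. *)
From HB Require Import structures.
From Stdlib Require Import ClassicalEpsilon.
From mathcomp Require Import all_boot all_order all_algebra.
From mathcomp Require Import all_fingroup all_solvable all_field all_character.

Set Implicit Arguments.
Unset Strict Implicit.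
Unset Printing Implicit Defensive.

Import Order.TTheory GRing.Theory Num.Theory.
Local Open Scope ring_scope.

(* A Young diagram is the list of its (nonzero) row lengths. *)
Definition is_part (n : nat) (s : seq nat) : bool :=
  [&& sorted geq s, 0%N \notin s & sumn s == n].

Record intpart (n : nat) : predArgType :=
  Intpart { rows :> seq nat; _ : is_part n rows }.

Section IntpartFinite.
Variable n : nat.

HB.instance Definition _ := [isSub for (@rows n)].
HB.instance Definition _ := [Countable of intpart n by <:].

Lemma size_le_sumn (s : seq nat) : 0%N \notin s -> (size s <= sumn s)%N.
Proof.
elim: s => //= -[|x] s IHs //; rewrite inE /= => /IHs.
by rewrite addSn ltnS => /leq_trans; apply; apply: leq_addl.
Qed.

Lemma leq_sumn_mem (s : seq nat) x : x \in s -> (x <= sumn s)%N.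
Proof.
elim: s => //= y s IHs; rewrite inE => /predU1P[->|/IHs]; first exact: leq_addr.
by move/leq_trans; apply; apply: leq_addl.
Qed.

Definition intpart_code (p : intpart n) : n.-bseq 'I_n.+1 :=
  insub_bseq n [seq inord x | x <- p].

Definition intpart_decode (b : n.-bseq 'I_n.+1) : option (intpart n) :=
  insub [seq val x | x <- b].

Lemma intpart_codeK : pcancel intpart_code intpart_decode.
Proof.
case=> s hs; have /and3P[_ s0 /eqP sn] := hs.
rewrite /intpart_decode /intpart_code /= /insub_bseq insubdK; last first.
  by rewrite -topredE /= size_map -[leqRHS]sn size_le_sumn.
rewrite -map_comp (_ : map _ s = s) ?insubT //.
rewrite -[RHS]map_id; apply/eq_in_map => x xs /=.
by rewrite inordK // ltnS -sn leq_sumn_mem.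
Qed.

HB.instance Definition _ : isFinite (intpart n) := PCanIsFinite intpart_codeK.

End IntpartFinite.

Definition adds_cell (gam lam : seq nat) : bool :=
  [exists k : 'I_(size gam).+1, lam == incr_nth gam k].

Notation "gam ≺ lam" := (adds_cell gam lam) (at level 70, no associativity).

(* Decreasing row [k] by one, then dropping it if it became empty and
   reordering. *)
Definition coef (lam gam : seq nat) : nat :=
  #|[set k : 'I_(size lam) |
      perm_eq [seq x <- set_nth 0%N lam k (nth 0%N lam k).-1 | x != 0%N] gam]|.

(* The cells of a diagram with [n] cells are numbered by ['I_n], row after row
   and from left to right in each row; this numbering is also the fixed filling
   used for the Young subgroup. *)
Definition cell_row (lam : seq nat) (k : nat) : nat := reshape_index lam k.
Definition cell_col (lam : seq nat) (k : nat) : nat := reshape_offset lam k.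

Section YoungPermutationRepresentation.
Variables (n : nat) (lam : intpart n).

Definition young_set : {set 'S_n} :=
  [set s : 'S_n | [forall k : 'I_n, cell_row lam (s k) == cell_row lam k]].

Lemma young_group_set : group_set young_set.
Proof.
apply/group_setP; split=> [|s t].
  by rewrite inE; apply/forallP => k; rewrite perm1.
rewrite !inE => /forallP hs /forallP ht; apply/forallP => k.
by rewrite permM (eqP (ht _)) hs.
Qed.

Canonical young_subgroup := Group young_group_set.

Definition Pi_char : 'CF([set: 'S_n]) :=
  'Ind[[set: 'S_n], young_subgroup] 1.

End YoungPermutationRepresentation.

(* A tableau is a permutation [t] putting the entry [t k] in the cell number
   [k]. *)
Definition is_standard (n : nat) (mu : intpart n) (t : 'S_n) : bool :=
  [forall k : 'I_n, forall l : 'I_n,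
    [|| (cell_row mu k == cell_row mu l) && (cell_col mu k < cell_col mu l)%N
      | (cell_col mu k == cell_col mu l) && (cell_row mu k < cell_row mu l)%N]
    ==> (t k < t l)%N].

Definition syt (n : nat) (mu : intpart n) : predArgType :=
  {t : 'S_n | is_standard mu t}.

Definition cell_content (mu : seq nat) (k : nat) : int :=
  (cell_col mu k)%:Z - (cell_row mu k)%:Z.

Definition syt_content (n : nat) (mu : intpart n) (T : syt mu) (i : 'I_n) : int :=
  cell_content mu ((val T)^-1%g i).

Definition jucys_murphy (n d : nat)
    (rG : mx_representation algC [set: 'S_n] d) (i : 'I_n) : 'M[algC]_d :=
  \sum_(j < n | (j < i)%N) rG (tperm j i).

(* Matrices act on row vectors from the right, the convention of
   [mx_representation]. *)
Definition has_young_basis (n : nat) (mu : intpart n) (d : nat)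
    (rG : mx_representation algC [set: 'S_n] d) : Prop :=
  exists v : syt mu -> 'rV[algC]_d,
    basis_of fullv [seq v T | T : syt mu] /\
    forall (T : syt mu) (i : 'I_n),
      v T *m jucys_murphy rG i = (syt_content T i)%:~R *: v T.

(* There is exactly one such index, so the choice is immaterial. *)
Definition young_irr (n : nat) (mu : intpart n) : Iirr [set: 'S_n] :=
  epsilon (inhabits 0) (fun i => has_young_basis mu 'Chi_i).

Definition mult (n : nat) (mu lam : intpart n) : algC :=
  '[Pi_char lam, 'chi_(young_irr mu)].

(* Main.v *)
Require Import Defs.
From mathcomp Require Import all_boot all_order all_algebra.
From mathcomp Require Import all_fingroup all_solvable all_field all_character.
From mathcomp Require Import ring zify.
From Stdlib Require Import ClassicalEpsilon.

(** By Frobenius reciprocity, the left-hand side is the multiplicity of the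
    representation of shape [rho] in the restriction of [Pi_lam] to the
    stabiliser of a point, provided that inducing that representation gives the
    sum of the representations of the shapes obtained by adding a cell to [rho].
    The right-hand side is the same multiplicity, because [Pi_lam] counts the
    colourings of the points with [lam_i] points of colour [i]
    ([Pi_char_colourings]): forgetting the colour of the last point
    ([card_colourings_lift]) expresses the restriction as the sum, over the rows
    of [lam], of the permutation characters of the diagrams in which that row
    has lost a cell, and grouping equal diagrams produces the coefficients
    ([sum_coef]).

    What needs work is the branching rule together with the identification of
    the labels by contents of tableaux. It is proved in the spirit of Okounkov
    and Vershik, by induction along the tower of the subgroups [fixer N k] of
    ['S_N] fixing the points from [k] on. Everything is read off from projectors
    onto isotypic components, one for each irreducible character of each group
    of the tower; projectors of different levels commute, and on a product of
    two consecutive ones a Jucys-Murphy element is a scalar, the difference of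
    the two content sums ([isoproj_jm]).

    Suppose that the irreducible characters of the first groups of the tower are
    labelled by diagrams, and let [V] be irreducible for the next group and
    contain the representation of shape [r]. Write [b] for the eigenvalue of the
    last Jucys-Murphy element there.
    - The relation [s X + 1 = Y s] between two consecutive Jucys-Murphy elements
      [X], [Y] and the transposition [s] that exchanges them leaves few values
      for [b] ([triple_dichotomy]), and the braid relation excludes those that
      are not the content of a cell that can be added to [r]
      ([content_addable]).
    - The trace of [s] against the projectors vanishes in the regular
      representation. This gives linear relations with a Cauchy matrix, from
      which at least as many values [b] occur as there are cells to add
      ([trace_sum], [cauchy_count]).
    - The double coset formula for two consecutive groups gives the sum of
      squares of the multiplicities, which is the same number ([Res_Ind_fixer]).
    So each cell that can be added to [r] accounts for one [V], with
    multiplicity one ([constituents]). Comparing the diagrams below and above,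
    [V] is labelled by the diagram obtained from [r] by adding the cell
    ([branching], [labelled_step]).

    Finally the products of the projectors along a chain of diagrams have rank
    one, and chains are the same as standard tableaux; this produces a Young
    basis in the representation labelled by [mu] ([young_basis_ex]) and shows
    that no other irreducible representation has one ([young_basis_uniq]). *)

Set Implicit Arguments.
Unset Strict Implicit.
Unset Printing Implicit Defensive.

Import Order.TTheory GRing.Theory Num.Theory.

(** * Young diagrams seen through their row lengths *)

Section Rows.
Local Notation row s i := (nth 0%N s i).
Implicit Types (s t u : seq nat).

Definition strip s := [seq x <- s | x != 0%N].

Lemma row_strip s i : sorted geq s -> row (strip s) i = row s i.
Proof.
elim: s i => [|x s IHs] i //= ss; have {IHs} IH := IHs _ (path_sorted ss).
case: x ss => [|x] ss /=; last by case: i => //= i; apply: IH.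
have s0 j : row s j = 0%N.
  have [js|js] := ltnP j (size s); last by rewrite nth_default.
  have /allP/(_ _ (mem_nth 0%N js)) := order_path_min (rev_trans leq_trans) ss.
  by rewrite /= leqn0 => /eqP.
by rewrite IH s0; case: i => //= i; rewrite s0.
Qed.

Lemma strip_sorted s : sorted geq s -> sorted geq (strip s).
Proof. exact/sorted_filter/(rev_trans leq_trans). Qed.

Lemma sumn_strip s : sumn (strip s) = sumn s.
Proof. by elim: s => //= -[|x] s IHs //=; rewrite IHs. Qed.

Lemma strip_part s : sorted geq s -> is_part (sumn s) (strip s).
Proof.
move=> ss; rewrite /is_part strip_sorted // sumn_strip eqxx andbT /=.
by rewrite mem_filter.
Qed.

Lemma sorted_rowP s :
  reflect (forall i, row s i.+1 <= row s i) (sorted geq s).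
Proof.
apply: (iffP (sortedP 0%N)) => [ss i|ss i _]; last exact: ss.
have [/ss //|] := ltnP i.+1 (size s).
by move=> h; rewrite [leqLHS]nth_default.
Qed.

Lemma is_part_anti n s i j : is_part n s -> i <= j -> row s j <= row s i.
Proof.
case/and3P=> /sorted_rowP ss _ _ /subnK<-.
elim: (j - i) => // d IHd; rewrite addSn; exact: leq_trans (ss _) IHd.
Qed.

Lemma is_part_gt0 n s i : is_part n s -> (0 < row s i) = (i < size s).
Proof.
case/and3P=> _ s0 _; have [h|h] := ltnP i (size s); last by rewrite nth_default.
by rewrite lt0n; apply: contraNneq s0 => <-; apply: mem_nth.
Qed.

(** Diagrams are compared row by row throughout, past the end of the list a row
    having length [0]; this is what makes linear arithmetic applicable. *)
Lemma is_part_eq n m s t :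
  is_part n s -> is_part m t -> (forall i, row s i = row t i) -> s = t.
Proof.
move=> hs ht e; apply: (@eq_from_nth _ 0%N) => [|i _]; last exact: e.
have h i : (i < size s) = (i < size t).
  by rewrite -(is_part_gt0 i hs) e (is_part_gt0 i ht).
by apply/eqP; rewrite eqn_leq leqNgt h ltnn leqNgt -h ltnn.
Qed.

Lemma is_part_size n s : is_part n s -> size s <= n.
Proof. by case/and3P=> _ s0 /eqP<-; apply: size_le_sumn. Qed.

Lemma sumn_row n s : size s <= n -> sumn s = \sum_(i < n) row s i.
Proof.
move=> h; rewrite sumnE (big_nth 0%N) big_mkord (big_ord_widen _ _ h) big_mkcond.
apply: eq_bigr => i _; case: ltnP => // g; by rewrite nth_default.
Qed.

(** Truncating a nonincreasing function at a zero and stripping the zeros keeps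
    all rows, since the zeros are at the end. *)
Lemma row_mkpart m (r : nat -> nat) i :
  (forall i, r i.+1 <= r i) -> r m = 0%N -> row (strip (mkseq r m)) i = r i.
Proof.
move=> dr rm; have rl j : row (mkseq r m) j = r j.
  have [h|h] := ltnP j m; first exact: nth_mkseq.
  rewrite nth_default ?size_mkseq //; apply/esym/eqP; rewrite -leqn0 -rm.
  rewrite -(subnK h); elim: (j - m) => [|d IHd]; first by rewrite add0n.
  by rewrite addSn (leq_trans (dr _)).
by rewrite row_strip ?rl //; apply/sorted_rowP => j; rewrite !rl.
Qed.

Lemma is_part_mkpart n m (r : nat -> nat) :
    (forall i, r i.+1 <= r i) -> r m = 0%N -> \sum_(i < m) r i = n ->
  is_part n (strip (mkseq r m)).
Proof.
move=> dr rm <-; have sl : sorted geq (mkseq r m).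
  apply/(sortedP 0%N) => i; rewrite size_mkseq => im.
  by rewrite !nth_mkseq //; [apply: dr | apply: ltnW].
rewrite (eq_bigr (fun i : 'I_m => row (mkseq r m) i)) => [|i _]; last by rewrite nth_mkseq.
by rewrite -sumn_row ?size_mkseq ?strip_part.
Qed.

Lemma is_part_ex n m (r : nat -> nat) :
    (forall i, r i.+1 <= r i) -> r m = 0%N -> \sum_(i < m) r i = n ->
  exists s : intpart n, forall i, row s i = r i.
Proof.
move=> dr rm sr; exists (Intpart (is_part_mkpart dr rm sr)) => i.
exact: row_mkpart.
Qed.

(** Stated for all rows, including those beyond the end of either diagram, so that
    creating a new row is not a separate case. *)
Definition adds_row (i : nat) s t := forall j, row t j = (i == j) + row s j.

Lemma adds_row_addable n i s t : is_part n t -> adds_row i s t ->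
  forall j, i = j.+1 -> row s j.+1 < row s j.
Proof.
move=> pt a j e; have := is_part_anti pt (leqnSn j).
rewrite !a e eqxx (negPf (_ : j.+1 != j)) //; lia.
Qed.

Lemma adds_row_removable n i s t : is_part n s -> adds_row i s t ->
  row t i.+1 < row t i.
Proof.
move=> ps a; have := is_part_anti ps (leqnSn i).
rewrite !a eqxx (negPf (_ : i != i.+1)) //; lia.
Qed.

Lemma adds_rowI i j s t : adds_row i s t -> adds_row j s t -> i = j.
Proof.
move=> ai aj; apply/eqP/negPn/negP => ij.
by have := ai i; rewrite aj eqxx eq_sym (negPf ij); lia.
Qed.

Lemma adds_cellP n m s t : is_part n s -> is_part m t ->
  reflect (exists i, adds_row i s t) (s ≺ t).
Proof.
move=> ps pt; apply: (iffP existsP) => [[i /eqP->]|[i ai]].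
  by exists (val i) => j; rewrite nth_incr_nth.
have ile : i < (size s).+1.
  rewrite ltnS leqNgt; apply/negP => si; have := adds_row_addable pt ai.
  case: i si ai => // i si ai /(_ i erefl).
  by rewrite [row s i]nth_default.
exists (Ordinal ile); apply/eqP/(@eq_from_nth _ 0%N) => [|j _] /=.
  apply/eqP; rewrite size_incr_nth eqn_leq leqNgt.
  have h j : (j < size t) = (j < (if i < size s then size s else i.+1)).
    rewrite -(is_part_gt0 j pt) ai; have := is_part_gt0 j ps.
    have [->|ij] := eqVneq i j; first by case: ifP; lia.
    by case: ifP => h; lia.
  by rewrite h ltnn leqNgt -h ltnn.
by rewrite nth_incr_nth ai.
Qed.

Lemma add_row_ex n s i : is_part n s ->
    (forall j, i = j.+1 -> row s j.+1 < row s j) ->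
  exists t : intpart n.+1, adds_row i s t.
Proof.
move=> ps hi; pose r j := ((i == j) + row s j)%N.
have szs := is_part_size ps.
have [|||t rt] := @is_part_ex n.+1 (i + n).+1 r.
- move=> j; rewrite /r; have := is_part_anti ps (leqnSn j).
  case: (eqVneq i j.+1) => [e|_] /=; last by lia.
  have := hi j e; lia.
- rewrite /r nth_default; last by lia.
  by rewrite (_ : (i == _) = false) //; lia.
- rewrite big_split /= -sumn_row; last by lia.
  case/and3P: ps => _ _ /eqP->; rewrite (bigD1 (inord i)) //= inordK ?eqxx; last by lia.
  rewrite big1 ?addn0 // => j /eqP ne; case: eqP => // e; case: ne.
  by apply: val_inj; rewrite /= inordK //; lia.
by exists t => j; rewrite rt.
Qed.

Lemma remove_row_ex n t i : is_part n.+1 t -> row t i.+1 < row t i ->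
  exists s : intpart n, adds_row i s t.
Proof.
move=> pt hi; pose r j := (row t j - (i == j))%N.
have szt := is_part_size pt.
have inn : i < n.+1.
  by apply: leq_trans szt; rewrite -(is_part_gt0 i pt); lia.
have [|||s rs] := @is_part_ex n n.+1 r.
- move=> j; rewrite /r; have := is_part_anti pt (leqnSn j).
  case: (eqVneq i j) => [<-|_] /=; first by rewrite (negPf (_ : i != i.+1)); lia.
  by case: eqP; lia.
- by rewrite /r nth_default.
- case/and3P: (pt) => _ _ /eqP e.
  suff : (\sum_(j < n.+1) r j).+1 = sumn t by rewrite e => -[].
  rewrite (sumn_row szt).
  rewrite (bigD1 (Ordinal inn)) //= [RHS](bigD1 (Ordinal inn)) //= /r eqxx.
  rewrite (eq_bigr (fun j : 'I_n.+1 => row t j)); first by lia.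
  move=> j; rewrite -val_eqE /= eq_sym => /negPf->; lia.
by exists s => j; rewrite rs /r; case: eqP => [<-|]; lia.
Qed.

(** The value, for the representation of shape [s], of the sum of all
    transpositions; its increments are the eigenvalues of Jucys-Murphy elements. *)
Definition cont_sum s : int :=
  (\sum_(i < size s) \sum_(j < row s i) (j%:Z - i%:Z))%R.

Lemma cont_sum_widen n s : size s <= n ->
  cont_sum s = (\sum_(i < n) \sum_(j < row s i) (j%:Z - i%:Z))%R.
Proof.
move=> h; rewrite /cont_sum.
rewrite (big_ord_widen _ (fun i : nat => \sum_(j < row s i) (j%:Z - i%:Z))%R h) big_mkcond.
apply: eq_bigr => i _; case: ltnP => // g; by rewrite nth_default // big_ord0.
Qed.

Lemma cont_sum_add n i s t : is_part n t -> adds_row i s t ->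
  cont_sum t = (cont_sum s + ((row s i)%:Z - i%:Z))%R.
Proof.
(* Large enough to compare the two sums over a common range of rows. *)
move=> pt a; pose M := (size s + size t + i).+1.
rewrite (@cont_sum_widen M t) ?(@cont_sum_widen M s) /M; try lia.
have iM : i < M by rewrite /M; lia.
rewrite (bigD1 (Ordinal iM)) //= [in RHS](bigD1 (Ordinal iM)) //= a eqxx.
rewrite big_ord_recr /= [LHS]addrAC; congr (_ + _ + _)%R; apply: eq_bigr => j.
by rewrite -val_eqE /= eq_sym a => /negPf->.
Qed.

End Rows.

(** * Diagrams that differ by one cell *)

Section Lattice.
Local Notation row s i := (nth 0%N s i).
Variable n : nat.
Implicit Types (r : intpart n) (m : intpart n.+1) (k : intpart n.+2).
Local Notation ct := cont_sum.

Lemma intpartP q (s : intpart q) : is_part q s. Proof. exact: valP. Qed.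
Hint Resolve intpartP : core.

Lemma adds_cellE q (s : intpart q) (t : intpart q.+1) :
  reflect (exists i, adds_row i s t) (s ≺ t).
Proof. exact: adds_cellP. Qed.

Lemma intpart_eq q (s t : intpart q) : (forall i, row s i = row t i) -> s = t.
Proof. by move=> e; apply/val_inj/(is_part_eq _ _ e). Qed.

(** The contents [r_i - i] of the cells that can be added strictly decrease with
    the row [i]. *)
Lemma up_inj r m m' : r ≺ m -> r ≺ m' -> ct m = ct m' -> m = m'.
Proof.
case/adds_cellE=> i a /adds_cellE[j b].
rewrite (cont_sum_add (intpartP _) a) (cont_sum_add (intpartP _) b) => e.
suff ij : i = j by apply: intpart_eq => l; rewrite a b ij.
have := @is_part_anti _ _ i j (intpartP r); have := @is_part_anti _ _ j i (intpartP r).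
by lia.
Qed.

Lemma down_inj r r' m : r ≺ m -> r' ≺ m -> ct r = ct r' -> r = r'.
Proof.
case/adds_cellE=> i a /adds_cellE[j b] e.
suff ij : i = j by apply: intpart_eq => l; have := a l; rewrite b ij; lia.
have := @is_part_anti _ _ i j (intpartP m); have := @is_part_anti _ _ j i (intpartP m).
have := cont_sum_add (intpartP m) a; rewrite (cont_sum_add (intpartP m) b) e.
by have := a i; have := b j; rewrite !eqxx; lia.
Qed.

(** If rows [i < j] both admit a new cell then [r_(j-1) > r_j], so the contents
    [r_i - i] and [r_j - j] differ by at least two. *)
Lemma up_gap r m m' : r ≺ m -> r ≺ m' -> (ct m - ct m' != 1)%R.
Proof.
case/adds_cellE=> i a /adds_cellE[j b].
rewrite (cont_sum_add (intpartP _) a) (cont_sum_add (intpartP _) b); apply/eqP => e.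
have ai := @adds_row_addable _ _ _ _ (intpartP m) a.
have aj := @adds_row_addable _ _ _ _ (intpartP m') b.
have [ij|ji|ij] := ltngtP i j; last by move: e; rewrite ij; lia.
- have := aj j.-1; have := @is_part_anti _ _ i j.-1 (intpartP r).
  by case: j ij e {b aj} => // j ij e /=; lia.
- by have := @is_part_anti _ _ j i (intpartP r); lia.
Qed.

(** The last row can always lose a cell. *)
Lemma removable_ex m : exists r, r ≺ m.
Proof.
have szm : 0 < size m.
  rewrite lt0n; case/and3P: (intpartP m) => _ _; case: (rows m) => //.
have [|r a] := @remove_row_ex n m (size m).-1 (intpartP m).
  by rewrite prednK // [ltnLHS]nth_default // (is_part_gt0 _ (intpartP m)) prednK.
by exists r; apply/adds_cellE; exists (size m).-1.
Qed.

(** Two cells that can be added to [r] lie in different rows and do not interfere: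
    the second one keeps its content after the first one has been added. *)
Lemma join_ex r m m' : r ≺ m -> r ≺ m' -> m != m' ->
  exists k, [/\ m ≺ k, m' ≺ k & ct k - ct m = ct m' - ct r]%R.
Proof.
case/adds_cellE=> i a /adds_cellE[j b] ne.
have ij : i != j.
  by apply: contraNneq ne => ij; apply/eqP/intpart_eq => l; rewrite a b ij.
have [|k c] := @add_row_ex n.+1 m j (intpartP m).
  move=> l e; have := adds_row_addable (intpartP m') b e.
  by rewrite !a -e (negPf ij); lia.
exists k; split; first by apply/adds_cellE; exists j.
  by apply/adds_cellE; exists i => l; rewrite c a b; lia.
rewrite (cont_sum_add (intpartP _) c) (cont_sum_add (intpartP _) b) a (negPf ij); lia.
Qed.

Lemma meet_ex m m' k : m ≺ k -> m' ≺ k -> m != m' ->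
  exists r, [/\ r ≺ m, r ≺ m' & ct k - ct m = ct m' - ct r]%R.
Proof.
case/adds_cellE=> i a /adds_cellE[j b] ne.
have ij : i != j.
  apply: contraNneq ne => ij; apply/eqP/intpart_eq => l.
  by have := a l; rewrite b ij; lia.
have [|r c] := @remove_row_ex n m j (intpartP m).
  have := adds_row_removable (intpartP m') b.
  by rewrite !a (negPf ij); lia.
have c' : adds_row i r m' by move=> l; have := c l; have := a l; rewrite b; lia.
exists r; split; [by apply/adds_cellE; exists j | by apply/adds_cellE; exists i |].
rewrite (cont_sum_add (intpartP _) a) (cont_sum_add (intpartP _) c') (c i).
by rewrite eq_sym (negPf ij); lia.
Qed.

Lemma meet_uniq r r' m m' : m != m' ->
  r ≺ m -> r ≺ m' -> r' ≺ m -> r' ≺ m' -> r = r'.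
Proof.
move=> ne /adds_cellE[i a] /adds_cellE[j b] /adds_cellE[i' a'] /adds_cellE[j' b'].
have ij : i != j.
  by apply: contraNneq ne => ij; apply/eqP/intpart_eq => l; rewrite a b ij.
suff ii : i = i' by apply: intpart_eq => l; have := a l; rewrite a' ii; lia.
have := a i; have := b i; have := a' i; have := b' i.
by rewrite eqxx [j == i]eq_sym (negPf ij); lia.
Qed.

Lemma remove_content m i : row m i.+1 < row m i ->
  exists2 r : intpart n, r ≺ m & (ct m - ct r = (row m i)%:Z - 1 - i%:Z)%R.
Proof.
move=> hi; have [r c] := remove_row_ex (intpartP m) hi.
exists r; first by apply/adds_cellE; exists i.
rewrite (cont_sum_add (intpartP _) c) //; have := c i; rewrite eqxx; lia.
Qed.

(** If the new cell, of content [a], stands at the end of row [i], a cell of content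
    [a + 1] can only go to its right, which is impossible exactly when row [i - 1]
    is not longer; then the last cell of row [i - 1] has content [a + 1] and can be
    removed from [m]. For [a - 1] the cell below and the left neighbour play the
    corresponding parts. *)
Lemma adjacent_content q (m : intpart q) (k : intpart q.+1) (b : int) : m ≺ k ->
    (b - (ct k - ct m) = 1 \/ b - (ct k - ct m) = -1)%R ->
  (exists2 l : intpart q.+2, k ≺ l & ct l - ct k = b)%R \/
  (exists2 i, row m i.+1 < row m i & ((row m i)%:Z - 1 - i%:Z = b)%R).
Proof.
case/adds_cellE=> i a hb; have ctk := cont_sum_add (intpartP k) a.
have ai := @adds_row_addable _ _ _ _ (intpartP k) a.
have ar := adds_row_removable (intpartP m) a.
case: hb => hb.
  have [hi|] := boolP ((i == 0) || (row k i < row k i.-1)).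
    have [|l c] := @add_row_ex q.+1 k i (intpartP k).
      by move=> j e; move: hi; rewrite e.
    left; exists l; first by apply/adds_cellE; exists i.
    rewrite (cont_sum_add (intpartP _) c) a eqxx; lia.
  rewrite negb_or => /andP[i0]; rewrite -leqNgt => hi.
  right; exists i.-1.
    by rewrite prednK ?lt0n //; have := ai i.-1; rewrite prednK ?lt0n //; lia.
  move: hi; rewrite !a !eqxx (_ : (i == i.-1) = false); last by lia.
  have := ai i.-1; rewrite prednK ?lt0n //; lia.
have [hi|hi] := eqVneq (row m i.+1) (row m i).
  have [|l c] := @add_row_ex q.+1 k i.+1 (intpartP k).
    by move=> j [<-].
  left; exists l; first by apply/adds_cellE; exists i.+1.
  rewrite (cont_sum_add (intpartP _) c) a (_ : (i == i.+1) = false); lia.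
right; exists i; last by lia.
by have := is_part_anti (intpartP m) (leqnSn i); lia.
Qed.

(** Row [i + 1] can receive a cell exactly when row [i] can lose one, and row [0]
    can always receive one. *)
Lemma card_up_le m :
  #|[set k : intpart n.+2 | m ≺ k]| <= #|[set r : intpart n | r ≺ m]|.+1.
Proof.
(* [ok k r]: [k] has its new cell just below the row from which [r] lost one. *)
pose ok k r := [exists i : 'I_n.+3,
  [&& r ≺ m, row m i == (row r i).+1 & row k i.+1 == (row m i.+1).+1]].
pose f k := [pick r | ok k r].
have rowk k i : adds_row i m k -> row k i = (row m i).+1 by move->; rewrite eqxx.
have fN k i : adds_row i m k -> f k = None -> i = 0.
  move=> a; rewrite /f; case: pickP => // no _; case: i a => // i a.
  have [|r c] := @remove_row_ex n m i (intpartP m).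
    exact: adds_row_addable (intpartP k) a _ erefl.
  have iN : i < n.+3.
    have : 0 < row k i.+1 by rewrite rowk.
    by rewrite (is_part_gt0 _ (intpartP k)); have := is_part_size (intpartP k); lia.
  have/negP[] := negbT (no r); apply/existsP; exists (Ordinal iN) => /=.
  rewrite (rowk _ _ a) eqxx (c i) eqxx eqxx andbT.
  by rewrite andbT; apply/adds_cellE; exists i.
have fS k r i : adds_row i m k -> f k = Some r -> exists2 j, i = j.+1 & adds_row j r m.
  move=> a; rewrite /f; case: pickP => // r'; rewrite /ok.
  move=> /existsP[j /and3P[/adds_cellE[l c] h1 h2]] [<-].
  have lj : l = j by apply/eqP; move: h1; rewrite (c j); lia.
  by exists j; rewrite -?lj //; apply/eqP; move: h2; rewrite (a j.+1) -lj; lia.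
(* The row of the new cell is [0], or follows from the diagram chosen by [f]. *)
have finj : {in [set k : intpart n.+2 | m ≺ k] &, injective f}.
  move=> k k'; rewrite !inE => /adds_cellE[i a] /adds_cellE[i' a'] e.
  suff ii : i = i' by apply: intpart_eq => l; rewrite a a' ii.
  case E: (f k) => [r|]; last by rewrite (fN _ _ a E) (fN k' i' a' _) -?e.
  have [j -> c] := fS _ _ _ a E; have [|j' -> c'] := fS _ r _ a'; first by rewrite -e.
  by rewrite (adds_rowI c c').
rewrite -(card_in_imset finj) -[in leqRHS](card_imset _ (@Some_inj _)).
pose D := [set Some x | x in [set r : intpart n | r ≺ m]].
have : f @: [set k : intpart n.+2 | m ≺ k] \subset None |: D.
  apply/subsetP => o /imsetP[k]; rewrite inE => /adds_cellE[i a] ->.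
  case E: (f k) => [r|]; rewrite !inE //=.
  apply/imsetP; exists r => //; rewrite inE.
  by have [j _ c] := fS _ _ _ a E; apply/adds_cellE; exists j.
move/subset_leq_card; rewrite cardsU1 => h; apply: leq_trans h _.
by rewrite -add1n leq_add2r leq_b1.
Qed.

End Lattice.
#[export] Hint Resolve intpartP : core.

(** * Standard tableaux as chains of diagrams *)

Section Chains.
Local Notation row s i := (nth 0%N s i).
Local Notation ct := cont_sum.

(** A path from the empty diagram in the graph of Young diagrams. Diagrams of
    different sizes have different types, so plain lists of rows are used. *)
Definition chain n (c : nat -> seq nat) :=
  (forall j, j <= n -> is_part j (c j)) /\ (forall j, j < n -> c j ≺ c j.+1).

Lemma chain_adds n c j : chain n c -> j < n -> exists i, adds_row i (c j) (c j.+1).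
Proof.
case=> pc ac jn; apply/(adds_cellP (pc j _) (pc j.+1 _)) => //; [exact: ltnW | exact: ac].
Qed.

Lemma chain_mono n c i j r : chain n c -> i <= j -> j <= n -> row (c i) r <= row (c j) r.
Proof.
move=> hc ij jn; elim: j ij jn => [|j IHj]; first by rewrite leqn0 => /eqP->.
rewrite leq_eqVlt => /predU1P[-> //|]; rewrite ltnS => ij jn.
apply: leq_trans (IHj ij (ltnW jn)) _; have [l a] := chain_adds hc jn.
by rewrite a leq_addl.
Qed.

(** Both chains start from the empty diagram, and [up_inj] applies at each step. *)
Lemma chain_eq n c c' : chain n c -> chain n c' ->
    (forall j, j < n -> (ct (c j.+1) - ct (c j) = ct (c' j.+1) - ct (c' j))%R) ->
  forall j, j <= n -> c j = c' j.
Proof.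
move=> [pc ac] [pc' ac'] e; elim=> [|j IHj] jn.
  have := is_part_size (pc 0 jn); have := is_part_size (pc' 0 jn).
  by rewrite !leqn0 => /nilP-> /nilP->.
have cj := IHj (ltnW jn); have := e j jn; rewrite cj => /addIr ej.
have ps := pc _ (ltnW jn); have pt := pc _ jn; have pt' := pc' _ jn.
have := @up_inj j (Intpart ps) (Intpart pt) (Intpart pt').
move/(_ (ac _ jn)); rewrite /= cj => /(_ (ac' _ jn) ej) /(congr1 (@rows _)).
by [].
Qed.

Section Cells.
Variables (n : nat) (mu : intpart n).

Let sumn_mu : sumn mu = n. Proof. by case/and3P: (intpartP mu) => _ _ /eqP. Qed.

Lemma cell_col_lt (k : 'I_n) : cell_col mu k < row mu (cell_row mu k).
Proof. by apply: reshape_offsetP; rewrite sumn_mu. Qed.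

Lemma cell_row_lt (k : 'I_n) : cell_row mu k < size mu.
Proof. by apply: reshape_indexP; rewrite sumn_mu. Qed.

Lemma cell_inj (k l : 'I_n) :
  cell_row mu k = cell_row mu l -> cell_col mu k = cell_col mu l -> k = l.
Proof.
move=> er ec; apply: ord_inj.
by rewrite -(reshape_indexK mu k) -(reshape_indexK mu l) -/(cell_row _ _) er -/(cell_col _ _) ec.
Qed.

Lemma cell_ex r q : q < row mu r -> exists k : 'I_n, cell_row mu k = r /\ cell_col mu k = q.
Proof.
move=> h; have kn : flatten_index mu r q < n by rewrite -[ltnRHS]sumn_mu flatten_indexP.
exists (Ordinal kn); rewrite /cell_row /cell_col /=.
by rewrite flatten_indexKl ?flatten_indexKr.
Qed.

(** The cells of a row occupy the columns [0], ..., without gaps. *)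
Lemma card_row_prefix r m : m <= row mu r ->
  #|[set k : 'I_n | (cell_row mu k == r) && (cell_col mu k < m)]| = m.
Proof.
move=> hm; have ex (q : 'I_m) : exists k : 'I_n, cell_row mu k = r /\ cell_col mu k = q.
  by apply: cell_ex; apply: leq_trans hm.
have [f fP] := fin_all_exists ex.
rewrite -[RHS]card_ord -(card_imset _ (_ : injective f)); last first.
  by move=> q q' e; apply: ord_inj; rewrite -(proj2 (fP q)) e (proj2 (fP q')).
apply: eq_card => k; rewrite inE; apply/andP/imsetP => [[/eqP kr km]|[q _ ->]].
  exists (Ordinal km) => //; have [fr fc] := fP (Ordinal km).
  by apply: cell_inj; rewrite ?fr ?fc.
by have [-> ->] := fP q.
Qed.

Lemma count_row_succ (T : 'S_n) (i : 'I_n) r :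
  #|[set k : 'I_n | (cell_row mu k == r) && (T k < i.+1)]| =
    (cell_row mu ((T^-1)%g i) == r) +
      #|[set k : 'I_n | (cell_row mu k == r) && (T k < i)]|.
Proof.
rewrite (cardsD1 ((T^-1)%g i)) !inE permKV ltnS leqnn andbT.
congr (_ + _); apply: eq_card => k; rewrite !inE ltnS.
have [->|ne] /= := eqVneq k; first by rewrite permKV ltnn andbF.
congr (_ && _); rewrite leq_eqVlt; case: eqP => //= /ord_inj e.
by move: ne; rewrite -e permK eqxx.
Qed.

Section FromTableau.
Variable T : 'S_n.
Hypothesis stdT : is_standard mu T.

Let cnt (j r : nat) := #|[set k : 'I_n | (cell_row mu k == r) && (T k < j)]|.

Lemma std_row (k l : 'I_n) :
  cell_row mu k = cell_row mu l -> cell_col mu k < cell_col mu l -> T k < T l.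
Proof.
move=> er ec; have /forallP/(_ k)/forallP/(_ l)/implyP := stdT; apply.
by rewrite er eqxx ec.
Qed.

Lemma std_col (k l : 'I_n) :
  cell_col mu k = cell_col mu l -> cell_row mu k < cell_row mu l -> T k < T l.
Proof.
move=> ec er; have /forallP/(_ k)/forallP/(_ l)/implyP := stdT; apply.
by rewrite ec eqxx er orbT.
Qed.

(** Rows increase, so the smaller entries of a row are those in the columns before. *)
Lemma cell_col_count (i : 'I_n) (k := (T^-1)%g i) : cell_col mu k = cnt i (cell_row mu k).
Proof.
have Tk : T k = i by rewrite /k permKV.
rewrite -(card_row_prefix (ltnW (cell_col_lt k))); apply: eq_card => l; rewrite !inE.
case: eqP => //= er; rewrite -Tk.
have [c|c|c] := ltngtP (cell_col mu l) (cell_col mu k).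
- by rewrite std_row.
- by apply/esym/negbTE; rewrite -leqNgt ltnW // std_row.
by rewrite (cell_inj er c) ltnn.
Qed.

Let cnt_dec j r : cnt j r.+1 <= cnt j r.
Proof.
have ex (k : 'I_n) : exists k' : 'I_n, cell_row mu k = r.+1 ->
    cell_row mu k' = r /\ cell_col mu k' = cell_col mu k.
  have [kr|ne] := eqVneq (cell_row mu k) r.+1; last by exists k => /eqP; rewrite (negPf ne).
  have [|k' h] := @cell_ex r (cell_col mu k); last by exists k'.
  by apply: leq_trans (cell_col_lt k) _; rewrite kr; apply: is_part_anti (intpartP mu) (leqnSn r).
have [f fP] := fin_all_exists ex.
have finj : {in [set k : 'I_n | (cell_row mu k == r.+1) && (T k < j)] &, injective f}.
  move=> k l; rewrite !inE => /andP[/eqP kr _] /andP[/eqP lr _] e.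
  by apply: cell_inj; rewrite ?kr ?lr // -(proj2 (fP k kr)) e (proj2 (fP l lr)).
rewrite /cnt -(card_in_imset finj); apply/subset_leq_card/subsetP => k' /imsetP[k].
rewrite !inE => /andP[/eqP kr kj] ->; have [fr fc] := fP k kr.
by rewrite fr eqxx /=; apply: ltn_trans kj; apply: std_col; rewrite ?fr ?kr.
Qed.

Let cnt_n j : cnt j n = 0.
Proof.
apply/eqP; rewrite cards_eq0; apply/eqP/setP => k; rewrite !inE.
apply/negP => /andP[/eqP e _]; have := cell_row_lt k; rewrite e.
by rewrite ltnNge (is_part_size (intpartP mu)).
Qed.

Let cnt_sum j : j <= n -> \sum_(r < n) cnt j r = j.
Proof.
move=> jn; transitivity #|[set k : 'I_n | T k < j]|.
  have rl (k : 'I_n) : cell_row mu k < n.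
    exact: leq_trans (cell_row_lt k) (is_part_size (intpartP mu)).
  rewrite -[RHS]sum1_card [RHS](partition_big (fun k => Ordinal (rl k)) xpredT) //=.
  apply: eq_bigr => r _; rewrite /cnt -sum1_card; apply: eq_bigl => k.
  by rewrite !inE -val_eqE /= andbC.
rewrite -(card_imset _ (@perm_inj _ T)) -[RHS]card_ord -sum1_card.
rewrite -[RHS]sum1_card (big_ord_widen _ (fun=> 1) jn); apply: eq_bigl => i.
apply/imsetP/idP => [[k]|ij]; first by rewrite inE => ? ->.
by exists ((T^-1)%g i); rewrite ?inE permKV.
Qed.

(** The diagram at time [j] consists of the cells with entries below [j]; it is a
    diagram because columns increase, and its rows are filled without gaps because
    rows increase. *)
Lemma syt_chain_ex : exists c, [/\ chain n c, c n = mu,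
    forall j r, row (c j) r = cnt j r &
    forall i : 'I_n, (ct (c i.+1) - ct (c i) = cell_content mu ((T^-1)%g i))%R].
Proof.
pose c j := strip (mkseq (cnt j) n).
have cE j r : row (c j) r = cnt j r by apply: row_mkpart.
have pc j : j <= n -> is_part j (c j) by move=> jn; apply: is_part_mkpart => //; apply: cnt_sum.
have ac (i : 'I_n) : adds_row (cell_row mu ((T^-1)%g i)) (c i) (c i.+1).
  by move=> r; rewrite !cE /cnt count_row_succ.
have hc : chain n c.
  split=> // j jn; apply/(adds_cellP (pc _ (ltnW jn)) (pc _ jn)).
  by exists (cell_row mu ((T^-1)%g (Ordinal jn))); apply: (ac (Ordinal jn)).
exists c; split=> // [|i].
  apply: is_part_eq (pc n (leqnn _)) (intpartP mu) _ => r.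
  rewrite cE /cnt -[RHS](card_row_prefix (leqnn _)); apply: eq_card => k; rewrite !inE ltn_ord.
  by case: eqP => //= <-; rewrite cell_col_lt.
rewrite (cont_sum_add (pc _ (ltn_ord i)) (ac i)) cE -cell_col_count /cell_content; lia.
Qed.
End FromTableau.

(** The chain gives back the row of each entry, as the row that grows, and then its
    column by [cell_col_count]. *)
Lemma chain_inj (T T' : syt mu) :
    (forall j r, j <= n -> #|[set k : 'I_n | (cell_row mu k == r) && (val T k < j)]| =
                 #|[set k : 'I_n | (cell_row mu k == r) && (val T' k < j)]|) ->
  T = T'.
Proof.
move=> e; apply: val_inj; apply: invg_inj; apply/permP => i.
have [c [_ _ cE _]] := syt_chain_ex (valP T).
have er : cell_row mu ((val T)^-1%g i) = cell_row mu ((val T')^-1%g i).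
  have := e i.+1 (cell_row mu ((val T)^-1%g i)) (ltn_ord i).
  by rewrite !count_row_succ e ?eqxx 1?ltnW // => /addIn; case: eqP.
apply: cell_inj => //; rewrite !cell_col_count ?(valP T) ?(valP T') // er e //; exact: ltnW.
Qed.

(** The entry [i] is placed in the cell added at time [i]. *)
Lemma chain_syt_ex c : chain n c -> c n = mu -> exists T : syt mu,
  forall i : 'I_n, (ct (c i.+1) - ct (c i) = syt_content T i)%R.
Proof.
move=> hc cn; have [pc ac] := hc.
have [f fP] := fin_all_exists (fun i : 'I_n => chain_adds hc (ltn_ord i)).
have col_lt (i : 'I_n) : row (c i) (f i) < row mu (f i).
  rewrite -cn; apply: leq_trans (chain_mono _ hc (ltn_ord i) (leqnn n)).
  by rewrite fP eqxx.
have [g gP] := fin_all_exists (fun i => cell_ex (col_lt i)).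
have ginj : injective g.
  have wlog_lt (i j : 'I_n) : i < j -> g i <> g j.
    move=> ij e; have [gr gc] := gP i; have [gr' gc'] := gP j.
    have := chain_mono (f i) hc ij (ltnW (ltn_ord j)); rewrite fP eqxx.
    by rewrite -gc e gc' -gr' -e gr ltnn.
  move=> i j e; apply: ord_inj; case: (ltngtP i j) => // h.
    by case: (wlog_lt _ _ h).
  by case: (wlog_lt _ _ h).
have std : is_standard mu (perm ginj)^-1%g.
  apply/forallP => k; apply/forallP => l; apply/implyP.
  set T := (_^-1)%g; have Tk q : g (T q) = q by rewrite -(permE ginj) permKV.
  rewrite -{1 2 3 4}(Tk k) -{1 2 3 4}(Tk l); move: (T k) (T l) => i j {k l}.
  have [gr gc] := gP i; have [gr' gc'] := gP j; rewrite gr gc gr' gc'.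
  move=> h; have [//|ji|ij] := ltngtP i j; last first.
    by move: h; rewrite (ord_inj ij) !ltnn !andbF.
  have mono r := chain_mono r hc ji (ltnW (ltn_ord i)).
  case/orP: h => /andP[/eqP e lt].
    by have := mono (f j); rewrite fP eqxx; move: lt; rewrite e; lia.
  have := leq_trans (is_part_anti (pc _ (ltn_ord j)) (ltnW lt)) (mono (f i)).
  by rewrite fP eqxx e ltnn.
exists (exist (fun t : 'S_n => is_standard mu t) _ std) => i.
have [gr gc] := gP i.
rewrite /syt_content /= invgK permE /cell_content gr gc.
rewrite (cont_sum_add (pc _ (ltn_ord i)) (fP i)); lia.
Qed.
End Cells.
End Chains.

(** * Isotypic projectors *)

Local Open Scope ring_scope.

(** In a rank factorisation [A = C R] of an idempotent, [R C] is the identity. *)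
Lemma mxtrace_idem d (A : 'M[algC]_d) : A *m A = A -> \tr A = (\rank A)%:R.
Proof.
move=> AA; have bb : row_base A *m col_base A = 1%:M.
  apply: (row_free_inj (row_base_free A)); rewrite mul1mx.
  apply: (row_full_inj (col_base_full A)).
  by rewrite [RHS]mulmx_base -(mulmxA (row_base A)) (mulmxA (col_base A)) !mulmx_base.
by rewrite -{1}(mulmx_base A) mxtrace_mulC bb mxtrace1.
Qed.

Lemma idem_tr0 d (A : 'M[algC]_d) : A *m A = A -> \tr A = 0 -> A = 0.
Proof.
move=> AA; rewrite mxtrace_idem // => /eqP.
by rewrite pnatr_eq0 mxrank_eq0 => /eqP.
Qed.

Section GroupAlgebra.
Variable gT : finGroupType.
Implicit Types (H K L M Q : {group gT}) (f g : gT -> algC).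

Definition supp K f := forall x, x \notin K -> f x = 0.
Definition gconv f g x := \sum_y f y * g (y^-1 * x)%g.
Definition gdelta (s x : gT) : algC := (x == s)%:R.

(** Elements of the group algebra are functions on the whole group, with [supp]
    recording the subgroup that carries them: the same function can then be made to
    act on representations of different subgroups. *)
Definition gact H d (rG : mx_representation algC H d) f :=
  \sum_(x in H) f x *: rG x.

(** The coefficients of the central idempotent of the group algebra of [K]
    attached to [i]. *)
Definition isoidem K (i : Iirr K) x : algC :=
  'chi_i 1%g / #|K|%:R * 'chi_i x^-1%g.

Lemma supp_sub K L f : K \subset L -> supp K f -> supp L f.
Proof. by move=> KL sf x xL; apply/sf/(contra _ xL)/subsetP. Qed.

Lemma supp_gconv K f g : supp K f -> supp K g -> supp K (gconv f g).
Proof.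
move=> sf sg x xK; apply: big1 => y _; have [yK|/sf->] := boolP (y \in K).
  by rewrite sg ?mulr0 // groupMl ?groupV.
by rewrite mul0r.
Qed.

Lemma supp_isoidem K (i : Iirr K) : supp K (isoidem i).
Proof. by move=> x xK; rewrite /isoidem [X in _ * X]cfun0 ?mulr0 // groupV. Qed.

Lemma supp_gdelta K s : s \in K -> supp K (gdelta s).
Proof. by move=> sK x; rewrite /gdelta; case: eqP => // ->; rewrite sK. Qed.

Lemma gact_gconv H d (rG : mx_representation algC H d) f g :
  supp H f -> gact rG (gconv f g) = gact rG f *m gact rG g.
Proof.
move=> sf; rewrite /gact mulmx_suml.
transitivity (\sum_(x in H) \sum_(y in H) (f y * g (y^-1 * x)%g) *: rG x).
  apply: eq_bigr => x Hx; rewrite /gconv scaler_suml [RHS]big_mkcond.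
  by apply: eq_bigr => y _; case: ifP => // /negbT/sf->; rewrite mul0r scale0r.
rewrite exchange_big; apply: eq_bigr => y Hy; rewrite mulmx_sumr.
rewrite (reindex_inj (mulgI y)) /=.
apply: eq_big => [x|x]; rewrite groupMl // => Hx.
by rewrite mulKg repr_mxM // -scalemxAl -scalemxAr scalerA.
Qed.

Lemma gact_gdelta H d (rG : mx_representation algC H d) s :
  s \in H -> gact rG (gdelta s) = rG s.
Proof.
move=> sH; rewrite /gact (bigD1 s) //= /gdelta eqxx scale1r big1 ?addr0 // => x.
by case/andP=> _ /negPf->; rewrite scale0r.
Qed.

Lemma gact_supp H K d (rG : mx_representation algC H d) f : K \subset H ->
  supp K f -> gact rG f = \sum_(x in K) f x *: rG x.
Proof.
move=> KH sf; rewrite /gact (big_setID K) /= (setIidPr KH) [X in _ + X]big1 ?addr0 //.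
by move=> x /setDP[_ /sf->]; rewrite scale0r.
Qed.

Lemma mxtrace_gact H K d (rG : mx_representation algC H d) f : K \subset H ->
  supp K f -> \tr (gact rG f) = \sum_(x in K) f x * cfRepr rG x.
Proof.
move=> KH sf; rewrite (gact_supp rG KH sf) raddf_sum /=; apply: eq_bigr => x Kx.
by rewrite mxtraceZ cfunE (subsetP KH) // mulr1n.
Qed.

Lemma supp_sum K f : supp K f -> \sum_x f x = \sum_(x in K) f x.
Proof.
move=> sf; rewrite [RHS]big_mkcond; apply: eq_bigr => x _.
by case: ifP => // /negbT/sf.
Qed.

(** The generalized orthogonality relation, as a statement on idempotents. *)
Lemma isoidem_irr K (i j : Iirr K) y :
  \sum_(x in K) isoidem i x * 'chi_j (x * y)%g = (i == j)%:R * 'chi_i y.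
Proof.
have := generalized_orthogonality_relation y j i; move/(canRL (mulVKf (neq0CG K))) => e.
under eq_bigr => x _ do rewrite /isoidem -mulrA [X in _ * X]mulrC.
rewrite -mulr_sumr e eq_sym; case: eqP => [->|]; last by rewrite !(mul0r,mulr0).
rewrite !mul1r; have := irr1_neq0 j; have := neq0CG K => ? ?; field.
by apply/andP.
Qed.

(** The idempotent of [i] keeps, in any representation, the copies of ['Chi_i] and
    kills the other constituents. Applied repeatedly, this reduces the trace of a
    product of projectors along a tower to branching multiplicities. *)
Lemma mxtrace_isoidem H K d (rG : mx_representation algC H d) (i : Iirr K) f :
    K \subset H -> supp K f ->
  \tr (gact rG (gconv (isoidem i) f)) = '['Res[K] (cfRepr rG), 'chi_i] * \tr (gact 'Chi_i f).
Proof.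
move=> KH sf; have sc := supp_gconv (supp_isoidem i) sf.
rewrite (mxtrace_gact _ KH sc) (mxtrace_gact _ (subxx _) sf) irrRepr.
transitivity (\sum_(y in K) \sum_(z in K) isoidem i y * f z * cfRepr rG (y * z)%g).
  transitivity (\sum_(x in K) \sum_(y in K) isoidem i y * f (y^-1 * x)%g * cfRepr rG x).
    apply: eq_bigr => x _; rewrite /gconv (supp_sum (K := K)) ?mulr_suml // => y.
    by move/supp_isoidem->; rewrite mul0r.
  rewrite exchange_big; apply: eq_bigr => y Ky /=.
  rewrite (reindex_inj (mulgI y)); apply: eq_big => [z|z _]; first by rewrite groupMl.
  by rewrite mulKg.
rewrite exchange_big mulr_sumr; apply: eq_bigr => z Kz /=.
transitivity (f z * \sum_(y in K) isoidem i y * 'Res[K] (cfRepr rG) (y * z)%g).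
  rewrite mulr_sumr; apply: eq_bigr => y Ky.
  by rewrite cfResE ?groupM // mulrCA mulrA.
rewrite mulrCA; congr (_ * _); set phi := 'Res[K] _.
transitivity (\sum_j '[phi, 'chi_j] * ((i == j)%:R * 'chi_i z)).
  transitivity (\sum_j '[phi, 'chi_j] * \sum_(y in K) isoidem i y * 'chi_j (y * z)%g).
    rewrite [in LHS](cfun_sum_cfdot phi).
    under [RHS]eq_bigr => j _ do rewrite mulr_sumr.
    rewrite [RHS]exchange_big; apply: eq_bigr => y Ky /=.
    rewrite sum_cfunE mulr_sumr; apply: eq_bigr => j _.
    by rewrite cfunE mulrCA.
  by apply: eq_bigr => j _; rewrite isoidem_irr.
rewrite (bigD1 i) //= eqxx mul1r big1 ?addr0 // => j /negPf ij.
by rewrite eq_sym ij mul0r mulr0.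
Qed.

Section Idempotents.
Variables (H : {group gT}) (d : nat) (rG : mx_representation algC H d).

Definition isoproj K (i : Iirr K) := gact rG (isoidem i).

Lemma isoproj_mul K (i j : Iirr K) : K \subset H ->
  isoproj i *m isoproj j = (i == j)%:R *: isoproj i.
Proof.
move=> KH; rewrite -gact_gconv; last exact: supp_sub (supp_isoidem i).
rewrite /isoproj /gact scaler_sumr; apply: eq_bigr => x _; rewrite scalerA; congr (_ *: _).
rewrite /gconv (supp_sum (K := K)) => [|y /supp_isoidem->]; last by rewrite mul0r.
transitivity ('chi_j 1%g / #|K|%:R * \sum_(y in K) isoidem i y * 'chi_j (y * x^-1)%g).
  rewrite mulr_sumr; apply: eq_bigr => y Ky; rewrite /(isoidem j) mulrCA; congr (_ * (_ * _)).
  by rewrite invMg invgK -(cfunJ 'chi_j (x^-1 * y)%g (groupVr Ky)) conjgE invgK mulgK.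
rewrite isoidem_irr; case: eqP => [->|_]; last by rewrite !(mul0r, mulr0).
by rewrite !mul1r.
Qed.

Lemma isoproj_idem K (i : Iirr K) : K \subset H -> isoproj i *m isoproj i = isoproj i.
Proof. by move=> KH; rewrite isoproj_mul // eqxx scale1r. Qed.

Lemma isoproj_sum K : K \subset H -> \sum_(i : Iirr K) isoproj i = 1%:M.
Proof.
move=> KH; transitivity (gact rG (gdelta 1%g)); last by rewrite gact_gdelta // repr_mx1.
rewrite /isoproj /gact exchange_big; apply: eq_bigr => x _ /=.
rewrite -scaler_suml; congr (_ *: _).
transitivity (#|K|%:R^-1 * cfReg K x^-1%g).
  rewrite cfReg_sum sum_cfunE mulr_sumr; apply: eq_bigr => i _.
  by rewrite cfunE /isoidem; field; rewrite ?neq0CG.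
rewrite cfRegE /gdelta invg_eq1; case: eqP => _; last by rewrite mulr0.
by rewrite mulr1n mulVf ?neq0CG.
Qed.

Lemma gact_comm_rG f h : h \in H -> (forall x, f (x ^ h)%g = f x) ->
  gact rG f *m rG h = rG h *m gact rG f.
Proof.
move=> hH fJ; rewrite /gact mulmx_suml mulmx_sumr.
rewrite [RHS](reindex_inj (conjg_inj h)) /=.
apply: eq_big => [x|x xH]; rewrite ?groupJr //.
by rewrite fJ -scalemxAl -scalemxAr -!repr_mxM ?groupJ // conjgE mulKVg.
Qed.

(** The idempotent is invariant by conjugation under [K], and fixed by what
    centralizes [K]. *)
Lemma isoproj_comm K (i : Iirr K) h : K \subset H -> h \in H -> h \in K \/ h \in 'C(K)%g ->
  isoproj i *m rG h = rG h *m isoproj i.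
Proof.
move=> KH hH hK; apply: gact_comm_rG => // x; rewrite /isoidem -conjVg; congr (_ * _).
case: hK => [hK|hK]; first by rewrite cfunJ.
have [xK|xK] := boolP (x^-1 \in K)%g.
  by rewrite conjgE -(centP hK _ xK) mulKg.
by rewrite !cfun0 // memJ_norm // (subsetP (cent_sub K)).
Qed.

Lemma gact_comm (A : 'M_d) K f : K \subset H -> supp K f ->
  (forall h, h \in K -> A *m rG h = rG h *m A) -> A *m gact rG f = gact rG f *m A.
Proof.
move=> KH sf AK; rewrite (gact_supp rG KH sf) mulmx_sumr mulmx_suml.
by apply: eq_bigr => x Kx; rewrite -scalemxAr -scalemxAl AK.
Qed.

Lemma isoproj_gact_comm K (i : Iirr K) f : K \subset H -> supp K f ->
  isoproj i *m gact rG f = gact rG f *m isoproj i.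
Proof.
move=> KH sf; apply: gact_comm (KH) sf _ => h hK.
by apply: isoproj_comm => //; [apply: (subsetP KH) | left].
Qed.

Lemma isoproj_isoproj_comm K L (i : Iirr K) (j : Iirr L) : L \subset K -> K \subset H ->
  isoproj i *m isoproj j = isoproj j *m isoproj i.
Proof. by move=> LK KH; apply: isoproj_gact_comm => //; apply: supp_sub LK (supp_isoidem j). Qed.

Lemma mxtrace_isoproj K (i : Iirr K) : K \subset H ->
  \tr (isoproj i) = '['Res[K] (cfRepr rG), 'chi_i] * 'chi_i 1%g.
Proof.
move=> KH; have s1 : supp K (gdelta 1) by apply: supp_gdelta.
have := mxtrace_isoidem rG i KH s1; rewrite gact_gdelta // repr_mx1 mxtrace1 -irr1_degree => <-.
rewrite gact_gconv; last exact: supp_sub (supp_isoidem i).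
by rewrite gact_gdelta // repr_mx1 mulmx1.
Qed.

(** An idempotent matrix of trace zero is zero. *)
Lemma isoproj_eq0 K (i : Iirr K) : K \subset H ->
  (isoproj i == 0) = ('['Res[K] (cfRepr rG), 'chi_i] == 0).
Proof.
move=> KH; apply/eqP/eqP => [e|e].
  have := mxtrace_isoproj i KH; rewrite e mxtrace0 => /esym/eqP.
  by rewrite mulf_eq0 (negPf (irr1_neq0 i)) orbF => /eqP.
by apply: idem_tr0; rewrite ?isoproj_idem // mxtrace_isoproj // e mul0r.
Qed.

(** A sum of elements of [K] permuted by conjugation acts on ['Chi_i] by a scalar,
    by the lemma of Schur, and the trace identifies the scalar. *)
Lemma central_sum (I : finType) (P : pred I) (t : I -> gT) K (i : Iirr K) : K \subset H ->
    (forall z, P z -> t z \in K) ->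
    (forall h, h \in K -> exists2 s : I -> I, injective s &
       forall z, P (s z) = P z /\ (P z -> (t z ^ h)%g = t (s z))) ->
  isoproj i *m (\sum_(z | P z) rG (t z)) = (\sum_(z | P z) 'chi_i (t z) / 'chi_i 1%g) *: isoproj i.
Proof.
move=> KH tK tJ; pose M := \sum_(z | P z) 'Chi_i (t z).
have [c Mc] : exists c, M = c%:M.
  apply/is_scalar_mxP; apply: (mx_abs_irr_cent_scalar (rG := 'Chi_i)).
    exact/groupC/socle_irr.
  apply/centgmxP => h Kh; rewrite /M mulmx_suml mulmx_sumr.
  have [s sI sE] := tJ h Kh; rewrite [RHS](reindex_inj sI) /=.
  apply: eq_big => [z|z Pz]; first by case: (sE z).
  case: (sE z) => _ <- //.
  by rewrite -!repr_mxM ?groupJ ?tK // conjgE mulKVg.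
have scal x : x \in K -> \sum_(z | P z) 'chi_i (x * t z)%g = c * 'chi_i x.
  move=> Kx; transitivity (\tr ('Chi_i x *m M)).
    rewrite /M mulmx_sumr raddf_sum; apply: eq_bigr => z Pz /=.
    by rewrite -irrRepr cfunE groupM ?tK // mulr1n repr_mxM ?tK.
  by rewrite Mc mul_mx_scalar mxtraceZ -[in RHS]irrRepr cfunE Kx mulr1n.
have cE : c = \sum_(z | P z) 'chi_i (t z) / 'chi_i 1%g.
  have := scal 1%g (group1 K); rewrite -mulr_suml.
  by under eq_bigr do rewrite mul1g; move=> ->; rewrite mulfK ?irr1_neq0.
rewrite -{}cE /isoproj (gact_supp rG KH (supp_isoidem i)) scaler_sumr mulmx_suml.
transitivity (\sum_(z | P z) \sum_(x in K) isoidem i (x * (t z)^-1)%g *: rG x).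
  under eq_bigr do rewrite mulmx_sumr.
  rewrite exchange_big; apply: eq_bigr => z Pz /=.
  rewrite [RHS](reindex_inj (mulIg (t z))) /=.
  apply: eq_big => [x|x Kx]; first by rewrite groupMr ?tK.
  by rewrite mulgK repr_mxM ?(subsetP KH) ?tK // scalemxAl.
rewrite exchange_big; apply: eq_bigr => x Kx /=; rewrite -scaler_suml scalerA.
congr (_ *: _); rewrite /isoidem mulrCA -scal ?groupV // mulr_sumr.
apply: eq_bigr => z Pz; congr (_ * _); rewrite invMg invgK.
by rewrite -(cfunJ 'chi_i _ (tK z Pz)) conjgE mulgA mulKg.
Qed.
End Idempotents.

Definition branch_mult K L (i : Iirr K) (j : Iirr L) : algC := '['Res[L] 'chi_i, 'chi_j].

Lemma branch_mult_nat K L (i : Iirr K) (j : Iirr L) : branch_mult i j \in Num.nat.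
Proof. by apply: Cnat_cfdot_char_irr; apply: cfRes_char; apply: irr_char. Qed.

Section Traces.
Variables (H : {group gT}) (d : nat) (rG : mx_representation algC H d).

Lemma mxtrace_isoproj2 K L (i : Iirr K) (j : Iirr L) : L \subset K -> K \subset H ->
  \tr (isoproj rG i *m isoproj rG j) = '['Res[K] (cfRepr rG), 'chi_i] * (branch_mult i j * 'chi_j 1%g).
Proof.
move=> LK KH; rewrite -gact_gconv; last exact: supp_sub (supp_isoidem i).
rewrite mxtrace_isoidem //; last exact: supp_sub (supp_isoidem j).
by rewrite mxtrace_isoproj // irrRepr.
Qed.

(** The product of commuting projectors is a projector, and its trace is a multiple
    of the branching multiplicity. *)
Lemma isoproj2_eq0 K L (i : Iirr K) (j : Iirr L) : L \subset K -> K \subset H ->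
  branch_mult i j = 0 -> isoproj rG i *m isoproj rG j = 0.
Proof.
move=> LK KH e; have LH := subset_trans LK KH.
apply: idem_tr0; last by rewrite mxtrace_isoproj2 // e mul0r mulr0.
have C := isoproj_isoproj_comm rG i j LK KH.
rewrite {1}C mulmxA -(mulmxA (isoproj rG j)) isoproj_idem // -C -mulmxA.
by rewrite isoproj_idem.
Qed.
End Traces.

Lemma isoproj_irr H (i j : Iirr H) : isoproj 'Chi_i j = (i == j)%:R%:M.
Proof.
have H0 k : i != k -> isoproj 'Chi_i k = 0.
  move=> /negPf ik; apply/eqP; by rewrite isoproj_eq0 // irrRepr cfRes_id cfdot_irr ik eqxx.
have [<-|/H0->] := eqVneq i j; last by rewrite raddf0.
rewrite -(isoproj_sum 'Chi_i (subxx H)) (bigD1 i) //= big1 ?addr0 // => k.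
by rewrite eq_sym => /H0.
Qed.

Lemma mxtrace_isoproj3 K L M (i : Iirr K) (j : Iirr L) (k : Iirr M) :
    M \subset L -> L \subset K ->
  \tr (isoproj 'Chi_i j *m isoproj 'Chi_i k) = branch_mult i j * (branch_mult j k * 'chi_k 1%g).
Proof. by move=> ML LK; rewrite mxtrace_isoproj2 // irrRepr. Qed.

Lemma mxtrace_isoproj4 K L M Q (i : Iirr K) (j : Iirr L) (k : Iirr M) (l : Iirr Q) :
    Q \subset M -> M \subset L -> L \subset K ->
  \tr (isoproj 'Chi_i j *m (isoproj 'Chi_i k *m isoproj 'Chi_i l)) =
  branch_mult i j * (branch_mult j k * (branch_mult k l * 'chi_l 1%g)).
Proof.
move=> QM ML LK; have MK := subset_trans ML LK; have QL := subset_trans QM ML.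
rewrite -!gact_gconv; try by [apply: supp_sub (supp_isoidem j) | apply: supp_sub (supp_isoidem k)].
rewrite mxtrace_isoidem ?irrRepr //; last first.
  by apply: supp_gconv; [apply: supp_sub (supp_isoidem k) | apply: supp_sub (supp_isoidem l)].
rewrite gact_gconv; last exact: supp_sub (supp_isoidem k).
by rewrite mxtrace_isoproj3.
Qed.

(** The left-hand side is the trace in the regular representation. *)
Lemma mxtrace_gact_reg H f : \sum_(i : Iirr H) 'chi_i 1%g * \tr (gact 'Chi_i f) = #|H|%:R * f 1%g.
Proof.
transitivity (\sum_(x in H) f x * cfReg H x).
  under eq_bigr => i _ do rewrite /gact raddf_sum mulr_sumr.
  rewrite exchange_big; apply: eq_bigr => x Hx /=; rewrite cfReg_sum sum_cfunE mulr_sumr.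
  apply: eq_bigr => i _; have e : \tr ('Chi_i x) = 'chi_i x by rewrite -irrRepr cfunE Hx mulr1n.
  by rewrite mxtraceZ cfunE e mulrCA.
rewrite (bigD1 1%g) //= cfRegE eqxx mulr1n mulrC big1 ?addr0 // => x /andP[_ /negPf x1].
by rewrite cfRegE x1 mulr0.
Qed.
End GroupAlgebra.

(** * The tower of symmetric groups and its Jucys-Murphy elements *)

Section Tower.
Variable N : nat.
Implicit Types (g h : 'S_N) (x y : 'I_N) (k : nat).

(** The symmetric group on the first [k] points, inside ['S_N]; working in one
    ambient group makes restriction and induction available without embeddings. *)
Definition fixer_set k : {set 'S_N} :=
  [set g : 'S_N | [forall i : 'I_N, (k <= i)%N ==> (g i == i)]].

Lemma fixerP k g : reflect (forall i : 'I_N, (k <= i)%N -> g i = i) (g \in fixer_set k).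
Proof.
rewrite inE; apply: (iffP forallP) => h i; first by move=> ki; apply/eqP/(implyP (h i)).
by apply/implyP => ki; apply/eqP/h.
Qed.

Lemma fixer_group_set k : group_set (fixer_set k).
Proof.
apply/group_setP; split=> [|g h /fixerP gk /fixerP hk]; apply/fixerP => i ki.
  by rewrite perm1.
by rewrite permM gk // hk.
Qed.
Canonical fixer k := Group (fixer_group_set k).
Local Notation G := fixer.

Lemma fixer_sub j k : (j <= k)%N -> G j \subset G k.
Proof.
move=> jk; apply/subsetP => g /fixerP gj; apply/fixerP => i ki.
exact/gj/(leq_trans jk).
Qed.

Lemma fixer_subS k : G k \subset G k.+1.
Proof. exact: fixer_sub (leqnSn k). Qed.

Lemma fixer_lt k g i : g \in G k -> (g i < k)%N = (i < k)%N.
Proof.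
move/fixerP=> gk; have [ki|ki] := leqP k i; first by rewrite gk // ltnNge ki.
rewrite ltnNge; apply/negP => kgi; have := gk _ kgi; move/perm_inj => e.
by move: kgi; rewrite e leqNgt ki.
Qed.

Lemma tperm_fixer k x y : (x < k)%N -> (y < k)%N -> tperm x y \in G k.
Proof.
by move=> xk yk; apply/fixerP => i ki; case: tpermP => // e; move: ki; rewrite e leqNgt (xk, yk).
Qed.

Lemma tperm_cent k x y : (k <= x)%N -> (k <= y)%N -> tperm x y \in 'C(G k)%g.
Proof.
move=> kx ky; apply/centP => g /fixerP gk; apply/commgP/conjg_fixP.
by rewrite tpermJ !gk.
Qed.

(** The cosets of the stabiliser of [y] are indexed by the image of [y]; products run
    from left to right, so [h * tperm j y] sends [y] to [j]. *)
Lemma sum_fixer_succ (R : nmodType) k y (f : 'S_N -> R) : y = k :> nat ->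
  \sum_(z in G k.+1) f z =
  \sum_(j : 'I_N | (j <= k)%N) \sum_(h in G k) f (h * tperm j y)%g.
Proof.
move=> yk; rewrite (partition_big (fun z : 'S_N => z y) (fun j : 'I_N => (j <= k)%N)) /=.
  apply: eq_bigr => j jk; rewrite (reindex_inj (mulIg (tperm j y))) /=.
  apply: eq_bigl => h; apply/andP/idP => [[/fixerP hG /eqP]|hG].
    rewrite permM => /(canRL (tpermK _ _)); rewrite tpermL => hy.
    apply/fixerP => i; rewrite leq_eqVlt => /predU1P[e|ki].
      by have -> : i = y by apply: ord_inj; rewrite -e yk.
    have := hG i ki; rewrite permM => /(canRL (tpermK _ _)) ->.
    by rewrite tpermD //; apply/eqP => e; move: ki; rewrite -e ?yk ltnNge (jk, leqnn).
  split.
    by rewrite groupMl ?tperm_fixer ?(subsetP (fixer_sub (leqnSn k))) ?yk.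
  by rewrite permM (fixerP _ _ hG) ?yk // tpermR.
by move=> z zG; rewrite -ltnS fixer_lt // yk.
Qed.

Lemma card_fixer_succ k y : y = k :> nat -> #|G k.+1| = (k.+1 * #|G k|)%N.
Proof.
move=> yk; rewrite -sum1_card (sum_fixer_succ _ yk) /=.
under eq_bigr do rewrite sum1_card.
rewrite sum_nat_const; congr (_ * _)%N.
have kN : (k.+1 <= N)%N by rewrite -yk.
rewrite -sum1_card -[RHS]card_ord -sum1_card.
by rewrite (big_ord_widen _ (fun=> 1%N) kN).
Qed.

Section JM.
Variables (H : {group 'S_N}) (d : nat) (rG : mx_representation algC H d).

(** Same as [jucys_murphy], for representations of arbitrary subgroups. *)
Definition jm_mx y : 'M_d := \sum_(j < N | (j < y)%N) rG (tperm j y).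

Definition transp_pairs k : pred ('I_N * 'I_N) :=
  [pred z : 'I_N * 'I_N | [&& (z.1 < k)%N, (z.2 < k)%N & z.1 != z.2]].

(** Ordered pairs see each transposition twice, whence the division by two. *)
Definition irr_content k (i : Iirr (G k)) : algC :=
  (\sum_(z | transp_pairs k z) 'chi_i (tperm z.1 z.2) / 'chi_i 1%g) / 2.

Definition transp_sum k : 'M_d := \sum_(z | transp_pairs k z) rG (tperm z.1 z.2).

Lemma isoproj_transp_sum k (i : Iirr (G k)) : G k \subset H ->
  isoproj rG i *m transp_sum k = (irr_content i *+ 2) *: isoproj rG i.
Proof.
move=> kH; rewrite /transp_sum (@central_sum _ _ _ _ _ (transp_pairs k) (fun z => tperm z.1 z.2) (G k)) //.
- by congr (_ *: _); rewrite -(mulr_natr (irr_content i)) /irr_content divfK ?pnatr_eq0.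
- by move=> z /and3P[? ? _]; apply: tperm_fixer.
move=> h hk; exists (fun z => (h z.1, h z.2)).
  by move=> [a b] [c e] /= [/perm_inj-> /perm_inj->].
move=> [a b]; rewrite /transp_pairs /= !fixer_lt // (inj_eq perm_inj); split=> // _.
by rewrite tpermJ.
Qed.

Lemma transp_sum_succ k y : y = k :> nat -> transp_sum k.+1 = transp_sum k + jm_mx y *+ 2.
Proof.
move=> yk; rewrite /transp_sum (bigID (transp_pairs k)) /=; congr (_ + _).
  apply: eq_bigl => z; rewrite /transp_pairs /=; lia.
rewrite mulr2n (bigID (fun z : 'I_N * 'I_N => z.1 == y)) /= addrC; congr (_ + _).
  rewrite [RHS](reindex_onto (fun z : 'I_N * 'I_N => z.1) (fun j => (j, y))) /= => [|//].
  apply: eq_big => [[a b]|[a b]] /=; rewrite ?xpair_eqE ?eqxx /=.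
    rewrite /transp_pairs /= -!val_eqE /= yk; lia.
  by rewrite /transp_pairs /= -!val_eqE /= => h; congr (rG (tperm _ _)); apply: val_inj => /=; lia.
rewrite [RHS](reindex_onto (fun z : 'I_N * 'I_N => z.2) (fun j => (y, j))) /= => [|//].
apply: eq_big => [[a b]|[a b]] /=; rewrite ?xpair_eqE ?eqxx ?andbT /=.
  rewrite /transp_pairs /= -!val_eqE /= yk; lia.
by rewrite tpermC => /andP[_ /eqP->].
Qed.

Lemma jm_comm k y g : y = k :> nat -> G k.+1 \subset H -> g \in G k ->
  jm_mx y *m rG g = rG g *m jm_mx y.
Proof.
move=> yk kH gk; have gk1 : g \in G k.+1 by apply: (subsetP (fixer_sub (leqnSn k))).
have gH := subsetP kH _ gk1; rewrite /jm_mx mulmx_suml mulmx_sumr.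
rewrite [RHS](reindex_inj (@perm_inj _ g)) /= yk.
apply: eq_big => [j|j jk]; first by rewrite fixer_lt.
have tH (z : 'I_N) : (z < k)%N -> tperm z y \in H.
  by move=> zk; apply/(subsetP kH)/tperm_fixer; rewrite ?yk // ltnW.
rewrite -!repr_mxM ?tH ?fixer_lt //; congr (rG _).
by rewrite -{2}(fixerP _ _ gk y) ?yk // -tpermJ conjgE mulKVg.
Qed.

Lemma jm_isoproj_comm k y (i : Iirr (G k)) : y = k :> nat -> G k.+1 \subset H ->
  jm_mx y *m isoproj rG i = isoproj rG i *m jm_mx y.
Proof.
move=> yk kH; apply: gact_comm (supp_isoidem i) _ => [|g gk].
  exact: subset_trans (fixer_sub (leqnSn k)) kH.
exact: jm_comm yk kH gk.
Qed.

Lemma jm_isoproj_comm_lt k y (i : Iirr (G k)) : (y < k)%N -> G k \subset H ->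
  jm_mx y *m isoproj rG i = isoproj rG i *m jm_mx y.
Proof.
move=> yk kH; rewrite /jm_mx mulmx_suml mulmx_sumr; apply: eq_bigr => j jy.
have tk : tperm j y \in G k by apply: tperm_fixer => //; apply: ltn_trans yk.
by rewrite isoproj_comm ?(subsetP kH) //; left.
Qed.

(** A Jucys-Murphy element is the difference of the sums of all transpositions of
    two consecutive groups of the tower, both of which are central. *)
Lemma isoproj_jm k y (i : Iirr (G k.+1)) (j : Iirr (G k)) : y = k :> nat -> G k.+1 \subset H ->
  isoproj rG i *m isoproj rG j *m jm_mx y =
    (irr_content i - irr_content j) *: (isoproj rG i *m isoproj rG j).
Proof.
move=> yk kH; have kk := fixer_sub (leqnSn k); have kH' := subset_trans kk kH.
have e1 : isoproj rG i *m isoproj rG j *m transp_sum k.+1 =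
    (irr_content i *+ 2) *: (isoproj rG i *m isoproj rG j).
  by rewrite (isoproj_isoproj_comm rG i j kk kH) -mulmxA isoproj_transp_sum // -scalemxAr.
have e2 : isoproj rG i *m isoproj rG j *m transp_sum k =
    (irr_content j *+ 2) *: (isoproj rG i *m isoproj rG j).
  by rewrite -mulmxA isoproj_transp_sum // -scalemxAr.
move: e1; rewrite (transp_sum_succ yk) mulmxDr e2 mulr2n mulmxDr -mulr2n.
move/(canRL (addKr _)) => e; have n2 : (2%:R : algC) != 0 by rewrite pnatr_eq0.
by apply: (scalerI n2); rewrite !scaler_nat [LHS]mulr2n e scalerMnl mulrnBl scalerBl addrC.
Qed.

(** Conjugation by the transposition of [x] and [y] turns [jm_mx y] into
    [jm_mx x], except for the term [tperm x y]. *)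
Lemma jm_rel k x y : x = k :> nat -> y = k.+1 :> nat -> G k.+2 \subset H ->
  rG (tperm x y) *m jm_mx x + 1%:M = jm_mx y *m rG (tperm x y).
Proof.
move=> xk yk kH; have tH (a b : 'I_N) : (a < k.+2)%N -> (b < k.+2)%N -> tperm a b \in H.
  by move=> *; apply/(subsetP kH)/tperm_fixer.
have sH : tperm x y \in H by apply: tH; rewrite ?xk ?yk.
rewrite [in RHS]/jm_mx (bigD1 x) /=; last by rewrite xk yk.
rewrite mulmxDl -repr_mxM // tperm2 repr_mx1 addrC; congr (_ + _).
rewrite mulmx_suml mulmx_sumr; apply: eq_big => [j|j jx].
  by rewrite -val_eqE /= xk yk; lia.
rewrite -!repr_mxM ?tH ?xk ?yk //; try lia.
congr (rG _); have -> : tperm j x = (tperm j y ^ tperm x y)%g.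
  rewrite tpermJ tpermR tpermD // -val_eqE /= ?xk ?yk; lia.
by rewrite conjgE mulgA mulgV mul1g.
Qed.

Section Local.
Variables (k : nat) (x y : 'I_N).
Hypotheses (xk : x = k :> nat) (yk : y = k.+1 :> nat) (kH : G k.+2 \subset H).
Variables (p : Iirr (G k.+2)) (t : Iirr (G k)).
Local Notation P r := (isoproj rG p *m isoproj rG r *m isoproj rG t).
Local Notation s := (tperm x y).

Let k1 : G k.+1 \subset G k.+2 := fixer_sub (leqnSn _).
Let k0 : G k \subset G k.+1 := fixer_sub (leqnSn _).
Let k1H : G k.+1 \subset H := subset_trans k1 kH.
Let k0H : G k \subset H := subset_trans k0 k1H.

Lemma triple_mul (r : Iirr (G k.+1)) r' : P r *m P r' = (r == r')%:R *: P r.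
Proof.
have C1 (M : 'M_d) (q : Iirr (G k.+1)) :
    M *m isoproj rG q *m isoproj rG p = M *m isoproj rG p *m isoproj rG q.
  by rewrite -!mulmxA (isoproj_isoproj_comm rG p q k1 kH).
have C2 (M : 'M_d) : M *m isoproj rG t *m isoproj rG p = M *m isoproj rG p *m isoproj rG t.
  by rewrite -!mulmxA (isoproj_isoproj_comm rG p t (subset_trans k0 k1) kH).
have C3 (M : 'M_d) : M *m isoproj rG t *m isoproj rG r' = M *m isoproj rG r' *m isoproj rG t.
  by rewrite -!mulmxA (isoproj_isoproj_comm rG r' t k0 k1H).
rewrite !mulmxA C2 C3 C1 (isoproj_idem rG p kH).
rewrite -(mulmxA _ (isoproj rG t) (isoproj rG t)) (isoproj_idem rG t k0H).
by rewrite -(mulmxA _ (isoproj rG r)) isoproj_mul // -scalemxAr -scalemxAl.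
Qed.

(** Multiply the relation [jm_rel] by projectors on both sides: each Jucys-Murphy
    element becomes a scalar. *)
Lemma triple_swap (r r' : Iirr (G k.+1)) :
  ((irr_content p - irr_content r) - (irr_content r' - irr_content t)) *: (P r *m rG s *m P r') =
    (r == r')%:R *: P r.
Proof.
have C1 := isoproj_isoproj_comm rG p r' k1 kH.
have C2 := isoproj_isoproj_comm rG p t (subset_trans k0 k1) kH.
have bP : P r *m jm_mx y = (irr_content p - irr_content r) *: P r.
  have Ct : isoproj rG t *m jm_mx y = jm_mx y *m isoproj rG t.
    apply/esym/gact_comm; [exact: k0H | exact: supp_isoidem | move=> g gk].
    by apply: jm_comm (yk) kH _; apply: (subsetP k0).
  by rewrite -[LHS]mulmxA Ct mulmxA isoproj_jm // -scalemxAl.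
have aP : jm_mx x *m P r' = (irr_content r' - irr_content t) *: P r'.
  have -> : P r' = isoproj rG r' *m isoproj rG t *m isoproj rG p.
    by rewrite C1 -!mulmxA C2.
  have Cx : jm_mx x *m (isoproj rG r' *m isoproj rG t) = isoproj rG r' *m isoproj rG t *m jm_mx x.
    rewrite mulmxA jm_isoproj_comm_lt ?xk // -!mulmxA; congr (_ *m _).
    exact: jm_isoproj_comm xk k1H.
  by rewrite mulmxA Cx isoproj_jm // -scalemxAl.
transitivity (P r *m jm_mx y *m rG s *m P r' - P r *m rG s *m (jm_mx x *m P r')).
  by rewrite bP aP scalerBl -!scalemxAl -scalemxAr.
rewrite -(mulmxA (P r)) -(jm_rel xk yk kH) mulmxDr mulmxDl mulmx1 triple_mul !mulmxA.
by rewrite addrAC subrr add0r.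
Qed.

Lemma triple_neq (r : Iirr (G k.+1)) :
  P r != 0 -> irr_content p - irr_content r != irr_content r - irr_content t.
Proof.
apply: contraNneq => e; have := triple_swap r r; rewrite e subrr scale0r eqxx scale1r.
by move=> <-.
Qed.

(** Decompose [P r * s] along the projectors [P r']. By [triple_swap] the component
    on [r'] vanishes unless the last two eigenvalues have been exchanged; if only
    the component on [r] remains, [s] acts by the scalar [(b - a)^-1], whose square
    is one. *)
Lemma triple_dichotomy (r : Iirr (G k.+1))
    (a := irr_content r - irr_content t) (b := irr_content p - irr_content r) : P r != 0 ->
  (exists r', [/\ r' != r, irr_content r' - irr_content t = b & P r' != 0]) \/
  [/\ P r *m rG s = (b - a)^-1 *: P r & b - a = 1 \/ b - a = -1].
Proof.
move=> Pn0; have sH : s \in H by apply/(subsetP kH)/tperm_fixer; rewrite ?xk ?yk.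
case: (pickP (fun r' : Iirr (G k.+1) => [&& r' != r, irr_content r' - irr_content t == b & P r' != 0])).
  by move=> r' /and3P[? /eqP ? ?]; left; exists r'.
move=> no; right.
have ba : b - a != 0 by rewrite subr_eq0 triple_neq.
have C2 := isoproj_isoproj_comm rG p t (subset_trans k0 k1) kH.
have Ps : P r *m rG s = (b - a)^-1 *: P r.
  transitivity (P r *m rG s *m (isoproj rG p *m isoproj rG t)).
    have sp : isoproj rG p *m rG s = rG s *m isoproj rG p.
      by apply: isoproj_comm => //; left; apply: tperm_fixer; rewrite ?xk ?yk.
    have st : isoproj rG t *m rG s = rG s *m isoproj rG t.
      by apply: isoproj_comm => //; right; apply: tperm_cent; rewrite ?xk ?yk.
    have C1 := isoproj_isoproj_comm rG p r k1 kH.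
    rewrite -[RHS]mulmxA (mulmxA (rG s)) -sp -(mulmxA (isoproj rG p) (rG s)) -st !mulmxA; congr (_ *m _).
    rewrite -(mulmxA _ (isoproj rG t) (isoproj rG p)) -C2 !mulmxA C1.
    rewrite -[in RHS](mulmxA (isoproj rG r)) isoproj_idem //.
    by rewrite -[RHS](mulmxA _ (isoproj rG t)) isoproj_idem.
  transitivity (P r *m rG s *m \sum_(r' : Iirr (G k.+1)) P r').
    congr (_ *m _); rewrite -!mulmx_suml -mulmx_sumr isoproj_sum ?mulmx1 //.
  rewrite mulmx_sumr (bigD1 r) //= big1 ?addr0 => [|r' r'r].
    apply: (scalerI ba); rewrite scalerA divff // scale1r.
    by rewrite triple_swap eqxx scale1r.
  have [->|P'0] := eqVneq (P r') 0; first by rewrite mulmx0.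
  have := no r'; rewrite r'r P'0 andbT /= => /negbT ne.
  have := triple_swap r r'; rewrite eq_sym (negPf r'r) scale0r => /eqP.
  by rewrite scalemx_eq0 subr_eq0 eq_sym (negPf ne) => /eqP.
split=> //; have : P r = ((b - a)^-1 * (b - a)^-1) *: P r.
  rewrite -scalerA -Ps scalemxAl -Ps -[RHS]mulmxA -repr_mxM // tperm2 repr_mx1 mulmx1 //.
move/eqP; rewrite -subr_eq0 -{1}[P r]scale1r -scalerBl scalemx_eq0 (negPf Pn0) orbF.
rewrite subr_eq0 -invfM eq_sym invr_eq1 -expr2 sqrf_eq1 => /orP[] /eqP; by [left | right].
Qed.
End Local.
End JM.
End Tower.

(** * Induction and restriction along the tower *)

Section Gram.
Variable N : nat.
Local Notation G := (@fixer N).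

(** The group [G k.+2] is made of two double cosets of [G k.+1], that of the identity
    and that of [tperm x y], which meets [G k.+1] and its conjugate along [G k]. *)
Lemma Res_Ind_fixer k (x y : 'I_N) (psi : 'CF(G k.+1)) : x = k :> nat -> y = k.+1 :> nat ->
  'Res[G k.+1] ('Ind[G k.+2] psi) = psi + 'Ind[G k.+1] ('Res[G k] psi).
Proof.
move=> xk yk; apply/cfun_inP => g gK.
have k1 := @fixer_sub N k.+1 k.+2 (leqnSn _); have k0 := @fixer_sub N k k.+1 (leqnSn _).
rewrite cfResE // cfunE !cfIndE //.
rewrite (sum_fixer_succ _ yk) (bigD1 y) /=; last by rewrite yk.
rewrite mulrDr; congr (_ + _).
  rewrite tperm1 (eq_bigr (fun=> psi g)) => [|h hK]; last by rewrite mulg1 cfunJ.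
  by rewrite sumr_const -[X in _ * X]mulr_natl mulrA mulVf ?mul1r ?neq0CG.
have main (j : 'I_N) : (j <= k.+1)%N && (j != y) ->
    \sum_(h in G k.+1) psi (g ^ (h * tperm j y))%g =
    \sum_(h in G k.+1) 'Res[G k] psi (g ^ h)%g.
  rewrite -val_eqE /= yk => /andP[jk jk'].
  have {jk jk'} jk : (j < k.+1)%N by rewrite ltn_neqAle jk' -ltnS.
  have uK : tperm j x \in G k.+1 by apply: tperm_fixer; rewrite ?xk.
  have tE : tperm j y = (tperm x y ^ tperm j x)%g.
    by rewrite tpermJ tpermR tpermD // -val_eqE /= ?xk ?yk; lia.
  rewrite (reindex_inj (mulIg (tperm j x))) /=.
  apply: eq_big => [h|h hK]; first by rewrite groupMr.
  have {}hK : h \in G k.+1 by rewrite groupMr in hK.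
  have -> : (h * tperm j x * tperm j y = h * tperm x y * tperm j x)%g.
    by rewrite tE conjgE !mulgA mulgK.
  rewrite conjgM cfunJ // conjgM.
  have guK : (g ^ h)%g \in G k.+1 by rewrite groupJ.
  have [gk|gk] := boolP ((g ^ h)%g \in G k).
    rewrite cfResE //; congr (psi _); apply/conjg_fixP/commgP/esym.
    have c : tperm x y \in 'C(G k)%g by apply: tperm_cent; rewrite ?xk ?yk.
    exact: (centP c).
  rewrite [RHS]cfun0 // cfun0 //; apply: contra gk => /fixerP e.
  apply/fixerP => i; rewrite leq_eqVlt => /predU1P[ik|]; last by move/fixerP: guK; apply.
  have -> : i = x by apply: ord_inj; rewrite xk.
  have := permJ (g ^ h)%g (tperm x y) x; rewrite tpermL e ?yk //.
  by move/esym/(canRL (tpermK _ _)); rewrite tpermR.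
rewrite (eq_bigr _ main) sumr_const.
have -> : #|[pred j : 'I_N | (j <= k.+1)%N && (j != y)]| = k.+1.
  have kN : (k.+1 <= N)%N by rewrite -yk ltnW.
  rewrite -[RHS]card_ord -!sum1_card (big_ord_widen _ (fun=> 1%N) kN).
  by apply: eq_bigl => j; rewrite !inE -val_eqE /= yk; lia.
rewrite (card_fixer_succ xk) -[X in _ * X]mulr_natl mulrA natrM invfM; congr (_ * _).
by rewrite mulrAC mulVf ?mul1r ?pnatr_eq0.
Qed.
End Gram.

(** * A Cauchy matrix argument *)

(** Clear denominators: the polynomial [q] below has degree less than the number of
    values of [b], and vanishes at all [a u]. It is not zero because its value at
    [b v0] is a sum of positive weights times a nonzero product. *)
Lemma cauchy_count (T U : finType) (I : {set T}) (A : {set U})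
    (W b : T -> algC) (a : U -> algC) :
    {in A &, injective a} -> (forall v, v \in I -> 0 < W v) -> I != set0 ->
    (forall v u, v \in I -> u \in A -> b v != a u) ->
    (forall u, u \in A -> \sum_(v in I) W v / (b v - a u) = 0) ->
  (#|A| < size (undup [seq b v | v in I]))%N.
Proof.
move=> ainj Wpos /set0Pn[v0 v0I] ba S0; set B := undup _.
have bB v : v \in I -> b v \in B by move=> vI; rewrite mem_undup; apply: image_f.
pose pr v := \prod_(c <- rem (b v) B) ('X - c%:P).
pose q := \sum_(v in I) W v *: pr v.
have szq : (size q <= size B)%N.
  apply: leq_trans (size_sum _ _ _) _; apply/bigmax_leqP => v vI.
  apply: leq_trans (size_scale_leq _ _) _.
  rewrite size_prod_XsubC size_rem ?bB // prednK //.
  by case: (B) (bB v vI).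
have prE v z : v \in I -> (z - b v) * (pr v).[z] = \prod_(c <- B) (z - c).
  move=> vI; rewrite (perm_big _ (perm_to_rem (bB v vI))) big_cons; congr (_ * _).
  by rewrite horner_prod; apply: eq_bigr => c _; rewrite hornerXsubC.
have qa u : u \in A -> root q (a u).
  move=> uA; rewrite rootE horner_sum; apply/eqP.
  transitivity (- (\prod_(c <- B) (a u - c)) * \sum_(v in I) W v / (b v - a u)).
    rewrite mulr_sumr; apply: eq_bigr => v vI; rewrite hornerZ -(prE v) //.
    by have n0 : b v - a u != 0; [rewrite subr_eq0 ba | field].
  by rewrite S0 // mulr0.
have q0 : q != 0.
  apply: contraTneq (Wpos _ v0I) => q0; have := congr1 (horner^~ (b v0)) q0.
  rewrite horner0 horner_sum (bigID (fun v => b v == b v0)) /= [X in _ + X]big1.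
    rewrite addr0 => e; have : (\sum_(v in I | b v == b v0) W v) * (pr v0).[b v0] = 0.
      rewrite mulr_suml -[RHS]e; apply: eq_bigr => v /andP[_ /eqP bv].
      by rewrite hornerZ /pr bv.
    move/eqP; rewrite mulf_eq0 => /orP[|].
      rewrite psumr_eq0 => [/allP/(_ v0)|v /andP[vI _]]; last exact/ltW/Wpos.
      by rewrite mem_index_enum v0I eqxx => /(_ isT) /eqP->; rewrite ltxx.
    rewrite horner_prod prodf_seq_eq0 => /hasP[c cB /=]; rewrite hornerXsubC subr_eq0.
    by move/eqP => e'; move: cB; rewrite -e' mem_rem_uniq ?undup_uniq // inE eqxx.
  move=> v /andP[vI bv]; apply/eqP; rewrite hornerZ mulf_eq0; apply/orP; right.
  have/eqP := prE v (b v0) vI; rewrite (big_rem (b v0)) ?bB //= subrr mul0r mulf_eq0.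
  by rewrite subr_eq0 eq_sym (negPf bv).
apply: leq_trans szq; rewrite cardE -(size_map a); apply: max_poly_roots q0 _ _.
  by apply/allP => z /mapP[u]; rewrite mem_enum => uA ->; apply: qa.
by rewrite map_inj_in_uniq ?enum_uniq // => u u'; rewrite !mem_enum; apply: ainj.
Qed.

(** * Irreducible characters labelled by diagrams *)

Section Main.
Variable N : nat.
Local Notation G := (@fixer N).
Local Notation ct s := (cont_sum s)%:~R.

(** Frobenius reciprocity turns the left-hand side into the inner product of two
    induced characters, which [Res_Ind_fixer] evaluates. *)
Lemma gram_branch_mult k (x y : 'I_N) (r r' : Iirr (G k.+1)) : x = k :> nat -> y = k.+1 :> nat ->
  \sum_(V : Iirr (G k.+2)) branch_mult V r * branch_mult V r' =
  (r == r')%:R + \sum_(t : Iirr (G k)) branch_mult r t * branch_mult r' t.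
Proof.
move=> xk yk; transitivity ('['Ind[G k.+2] 'chi_r, 'Ind[G k.+2] 'chi_r']).
  rewrite cfdot_sum_irr; apply: eq_bigr => V _.
  have E q : '['Ind[G k.+2] 'chi_q, 'chi_V] = branch_mult V q.
    by rewrite -Frobenius_reciprocity cfdotC conj_natr // branch_mult_nat.
  by rewrite !E conj_natr // branch_mult_nat.
rewrite -Frobenius_reciprocity (Res_Ind_fixer _ xk yk) cfdotDr cfdot_irr; congr (_ + _).
rewrite cfdotC -Frobenius_reciprocity cfdot_sum_irr rmorph_sum; apply: eq_bigr => t _ /=.
by rewrite rmorphM /= conjCK mulrC conj_natr ?branch_mult_nat.
Qed.

(** The character of shape [m] is characterised by its content sum and its
    restriction; [labelled_branches] shows that it exists for [k <= N], so that the
    default value [0] is never used. *)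
Fixpoint part_irr k : intpart k -> Iirr (G k) :=
  match k with
  | 0 => fun=> 0
  | k'.+1 => fun m => odflt 0 [pick i : Iirr (G k'.+1) | (irr_content i == ct m)
      && [forall r : intpart k', branch_mult i (part_irr r) == (r ≺ m)%:R]]
  end.

(** Together, [labelled] and [branches] form the induction hypothesis. *)
Definition labelled k := [/\ injective (@part_irr k), forall i, exists s, @part_irr k s = i &
  forall s : intpart k, irr_content (part_irr s) = ct s].
Definition branches k := forall (r : intpart k) (m : intpart k.+1),
  branch_mult (part_irr m) (part_irr r) = (r ≺ m)%:R.

Lemma part_irr_eq k (s s' : intpart k) : labelled k -> (part_irr s == part_irr s') = (s == s').
Proof. by case=> i _ _; apply: inj_eq. Qed.

Lemma sum_part_irr k (f : Iirr (G k) -> algC) : labelled k ->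
  \sum_i f i = \sum_(s : intpart k) f (part_irr s).
Proof.
case=> inj surj _; rewrite (reindex (@part_irr k)) //; apply/onW_bij.
pose g i := xchoose (let: ex_intro s e := surj i in ex_intro _ s (introT eqP e)).
have gK : cancel g (@part_irr k).
  by move=> i; apply/eqP/(xchooseP (let: ex_intro s e := surj i in ex_intro _ s (introT eqP e))).
by exists g => // s; apply: inj.
Qed.

End Main.

Section Step.
Variable N : nat.
Local Notation G := (@fixer N).
Local Notation row s i := (nth 0%N s i).
Local Notation ct s := (cont_sum s)%:~R.

Lemma isoproj3_neq0 k (V : Iirr (G k.+2)) (r : Iirr (G k.+1)) (t : Iirr (G k)) :
    branch_mult V r != 0 -> branch_mult r t != 0 ->
  isoproj 'Chi_V V *m isoproj 'Chi_V r *m isoproj 'Chi_V t != 0.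
Proof.
move=> Vr rt; rewrite isoproj_irr eqxx mul1mx; apply/eqP => e.
have := @mxtrace_isoproj3 _ _ _ _ V r t (fixer_subS N _) (fixer_subS N _).
rewrite e mxtrace0 => /esym/eqP; rewrite mulf_eq0 (negPf Vr) mulf_eq0 (negPf rt) /=.
by rewrite (negPf (irr1_neq0 _)).
Qed.

Lemma intB (a b : int) : a%:~R - b%:~R = (a - b)%:~R :> algC.
Proof. by rewrite intrB. Qed.

Lemma braid (x y z : 'I_N) : x != y -> y != z -> x != z ->
  (tperm y z * tperm x y * tperm y z = tperm x y * tperm y z * tperm x y)%g.
Proof.
move=> xy yz xz; transitivity (tperm x z).
  have -> : tperm x z = (tperm x y ^ tperm y z)%g by rewrite tpermJ tpermL tpermD // eq_sym.
  by rewrite conjgE tpermV mulgA.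
have -> : tperm x z = (tperm y z ^ tperm x y)%g.
  by rewrite tpermJ tpermR tpermD.
by rewrite conjgE tpermV mulgA.
Qed.

(** The transpositions act on [Q] by [c] and [- c]; the braid relation then gives
    [- c ^+ 3 = c ^+ 3]. *)
Lemma braid_absurd k (x y z : 'I_N) (V : Iirr (G k.+3)) (r : Iirr (G k.+2)) (t : Iirr (G k.+1))
    (u : Iirr (G k)) (c : algC) :
    x = k :> nat -> y = k.+1 :> nat -> z = k.+2 :> nat -> c != 0 ->
    branch_mult V r != 0 -> branch_mult r t != 0 -> branch_mult t u != 0 ->
    isoproj 'Chi_V V *m isoproj 'Chi_V r *m isoproj 'Chi_V t *m 'Chi_V (tperm y z) =
      c *: (isoproj 'Chi_V V *m isoproj 'Chi_V r *m isoproj 'Chi_V t) ->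
    isoproj 'Chi_V r *m isoproj 'Chi_V t *m isoproj 'Chi_V u *m 'Chi_V (tperm x y) =
      - c *: (isoproj 'Chi_V r *m isoproj 'Chi_V t *m isoproj 'Chi_V u) ->
  False.
Proof.
move=> xk yk zk c0 Vr rt tu; rewrite isoproj_irr eqxx mul1mx; set Q := _ *m isoproj _ u => Es Es'.
have sG (a b : 'I_N) : (a < k.+3)%N -> (b < k.+3)%N -> tperm a b \in G k.+3.
  exact: tperm_fixer.
have yzG : tperm y z \in G k.+3 by apply: sG; rewrite ?yk ?zk.
have xyG : tperm x y \in G k.+3 by apply: sG; rewrite ?xk ?yk //; lia.
have kG : G k \subset G k.+3 by apply: fixer_sub; lia.
have {}Es : Q *m 'Chi_V (tperm y z) = c *: Q.
  rewrite /Q -[LHS]mulmxA isoproj_comm //; last first.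
    by right; apply: tperm_cent; rewrite ?yk ?zk ?leqW.
  by rewrite [LHS]mulmxA Es -scalemxAl.
have /eqP : Q *m 'Chi_V (tperm y z * tperm x y * tperm y z)%g =
    Q *m 'Chi_V (tperm x y * tperm y z * tperm x y)%g.
  by rewrite braid // -val_eqE /= ?xk ?yk ?zk; lia.
rewrite !repr_mxM ?groupM //.
move: Es Es'; move: ('Chi_V (tperm y z)) ('Chi_V (tperm x y)) => S S' Es Es'.
rewrite !mulmxA Es Es' -!scalemxAl Es Es' -!scalemxAl Es Es' !scalerA.
rewrite -subr_eq0 -scalerBl scalemx_eq0 => /orP[/eqP e|/eqP Q0].
  have : c ^+ 3 *+ 2 = 0 by rewrite -[RHS]oppr0 -e; ring.
  by move/eqP; rewrite mulrn_eq0 expf_eq0 /= (negPf c0).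
have := @mxtrace_isoproj4 _ _ _ _ _ V r t u (fixer_subS N _) (fixer_subS N _) (fixer_subS N _).
rewrite mulmxA -/Q Q0 mxtrace0 => /esym/eqP.
by rewrite mulf_eq0 (negPf Vr) mulf_eq0 (negPf rt) mulf_eq0 (negPf tu) (negPf (irr1_neq0 _)).
Qed.

Lemma isoproj4_neq0 k (V : Iirr (G k.+3)) (r : Iirr (G k.+2)) (t : Iirr (G k.+1)) (u : Iirr (G k)) :
    branch_mult V r != 0 -> branch_mult r t != 0 -> branch_mult t u != 0 ->
  isoproj 'Chi_V r *m isoproj 'Chi_V t *m isoproj 'Chi_V u != 0.
Proof.
move=> Vr rt tu; apply/eqP => e.
have := @mxtrace_isoproj4 _ _ _ _ _ V r t u (fixer_subS N _) (fixer_subS N _) (fixer_subS N _).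
rewrite mulmxA e mxtrace0 => /esym/eqP.
by rewrite mulf_eq0 (negPf Vr) mulf_eq0 (negPf rt) mulf_eq0 (negPf tu) (negPf (irr1_neq0 _)).
Qed.

Lemma isoproj_down k (H : {group 'S_N}) d (rG : mx_representation algC H d) (A : 'M_d)
    (r : intpart k.+1) (t : intpart k) : G k.+1 \subset H -> branches N k ->
  A *m isoproj rG (part_irr N r) *m isoproj rG (part_irr N t) != 0 -> t ≺ r.
Proof.
move=> kH Br; apply: contraNT => e; rewrite -mulmxA.
by rewrite (isoproj2_eq0 rG (fixer_subS N _) kH) ?mulmx0 // Br (negPf e).
Qed.

(** Suppose that [b] is the content of a removable cell of [t], and let [u] be the
    diagram without it. Going from [u] to [r] the cells of contents [b] and [b +- 1]
    are added one after the other; no other order is possible by [up_gap], so the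
    transposition of [x] and its predecessor acts by the scalar opposite to the one
    in the hypothesis, and [braid_absurd] applies. *)
Lemma blocked_cell_absurd k (x y : 'I_N) (V : Iirr (G k.+2)) (r : intpart k.+1) (t : intpart k)
    i (b : int) :
    x = k :> nat -> y = k.+1 :> nat ->
    (forall j, (j <= k.+1)%N -> labelled N j) -> (forall j, (j <= k)%N -> branches N j) ->
    branch_mult V (part_irr N r) != 0 -> t ≺ r -> (row t i.+1 < row t i)%N ->
    (row t i)%:Z - 1 - i%:Z = b ->
    irr_content V - ct r = b%:~R ->
    b - (cont_sum r - cont_sum t) = 1 \/ b - (cont_sum r - cont_sum t) = -1 ->
    isoproj 'Chi_V V *m isoproj 'Chi_V (part_irr N r) *m isoproj 'Chi_V (part_irr N t) *m
      'Chi_V (tperm x y) =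
      (irr_content V - ct r - (ct r - ct t))^-1 *:
        (isoproj 'Chi_V V *m isoproj 'Chi_V (part_irr N r) *m isoproj 'Chi_V (part_irr N t)) ->
  False.
Proof.
case: k => [|k] in V r t *; move=> xk yk Lev Br Vr tr hi ei eb hb Ps.
  by move: hi; have := is_part_size (intpartP t); rewrite leqn0 => /nilP->; rewrite !nth_nil.
have [u ut eu] := remove_content hi; rewrite ei in eu.
have Fc j (s : intpart j) : (j <= k.+2)%N -> irr_content (part_irr N s) = ct s by case/Lev.
have kk : (k <= k.+2)%N by lia.
have wN : (k < N)%N by rewrite ltnW // -xk.
pose w := Ordinal wN; have wk : w = k :> nat by [].
have rt : branch_mult (part_irr N r) (part_irr N t) != 0 by rewrite Br // tr oner_eq0.
have tu : branch_mult (part_irr N t) (part_irr N u) != 0 by rewrite Br // ut oner_eq0.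
have [[t' [t't]]|] := triple_dichotomy wk xk (fixer_subS N _) (isoproj4_neq0 Vr rt tu).
  have [_ /(_ t')[s e] _] := Lev k.+1 (leqnSn _); rewrite -{t'}e in t't *.
  rewrite !Fc // !intB => /intr_inj es n0.
  have us : u ≺ s.
    apply: isoproj_down n0; first by apply: fixer_sub; lia.
    by apply: Br; lia.
  have g1 := up_gap us ut; have g2 := up_gap ut us.
  by case: hb => h; [case/eqP: g2 | case/eqP: g1]; lia.
rewrite !Fc // => -[Ps' _].
have c0 : (irr_content V - ct r - (ct r - ct t))^-1 != 0.
  by rewrite eb !intB invr_eq0 intr_eq0; lia.
apply: (braid_absurd wk xk yk c0 Vr rt tu Ps); rewrite Ps'; congr (_ *: _).
by rewrite eb -eu -invrN !intB -intrN; congr (_%:~R^-1); lia.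
Qed.

Variables (k : nat) (x y : 'I_N).
Hypotheses (xk : x = k :> nat) (yk : y = k.+1 :> nat).
Hypotheses (Lev : forall j, (j <= k.+1)%N -> labelled N j) (Br : forall j, (j <= k)%N -> branches N j).

Let F j := @part_irr N j.
Let Fc j (s : intpart j) : (j <= k.+1)%N -> irr_content (F s) = ct s.
Proof. by case/Lev. Qed.

Let ex_label j (i : Iirr (G j)) : (j <= k.+1)%N -> exists s, i = F s.
Proof. by case/Lev => _ /(_ i)[s <-] _; exists s. Qed.

Let down_of_triple (V : Iirr (G k.+2)) (r : intpart k.+1) (t : intpart k) d
    (rG : mx_representation algC (G k.+2) d) :
  isoproj rG V *m isoproj rG (F r) *m isoproj rG (F t) != 0 -> branch_mult V (F r) != 0 /\ t ≺ r.
Proof.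
move=> n0; split.
  apply: contraNneq n0 => e.
  by rewrite (isoproj2_eq0 rG (fixer_subS N _) _ e) ?mul0mx.
by apply: isoproj_down n0; [apply: fixer_subS | apply: Br].
Qed.

(** Remove a cell, of content [a], from [r] to get [t]. Either [b] is the content of
    another cell that can be added to [t], which remains available in [r], or
    [b = a +- 1]; then [adjacent_content] applies, and its second case is
    [blocked_cell_absurd]. *)
Lemma content_addable (V : Iirr (G k.+2)) (r : intpart k.+1) :
  branch_mult V (F r) != 0 -> exists2 m : intpart k.+2, r ≺ m & irr_content V = ct m.
Proof.
move=> Vr; have [t tr] := removable_ex r.
have rt : branch_mult (F r) (F t) != 0 by rewrite Br // tr oner_eq0.
have [[r' [r'r]]|] := triple_dichotomy xk yk (subxx _) (isoproj3_neq0 Vr rt).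
  have [s e] := ex_label r' (leqnn _); rewrite {r'}e in r'r *.
  rewrite !Fc // => e /down_of_triple[_ ts].
  have rs : r != s by apply: contraNneq r'r => ->.
  have [m [rm _ em]] := join_ex tr ts rs; exists m => //.
  have := congr1 (intr : int -> algC) em; rewrite !intrB e => /(canLR (subrK _)).
  by rewrite subrK.
rewrite !Fc // => -[Ps ba].
have [b eb hb] : exists2 b : int, irr_content V - ct r = b%:~R &
    b - (cont_sum r - cont_sum t) = 1 \/ b - (cont_sum r - cont_sum t) = -1.
  case: ba => ba; [exists (cont_sum r - cont_sum t + 1) | exists (cont_sum r - cont_sum t - 1)].
  - by move/(canRL (subrK _)): ba => ->; rewrite intB [RHS]intrD addrC.
  - by left; lia.
  - by move/(canRL (subrK _)): ba => ->; rewrite intB [RHS]intrB addrC.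
  - by right; lia.
have [[m rm em]|[i hi ei]] := adjacent_content tr hb.
  by exists m => //; rewrite -[LHS](subrK (ct r)) eb -em intrB subrK.
by case: (blocked_cell_absurd xk yk Lev Br Vr tr hi ei eb hb Ps).
Qed.

(** The contents of the two removable cells of [m] differ by at least two, so that
    the second case of [triple_dichotomy] is impossible. *)
Lemma content_down (V : Iirr (G k.+2)) (r r' : intpart k.+1) (m : intpart k.+2) :
    branch_mult V (F r) != 0 -> r ≺ m -> irr_content V = ct m -> r' ≺ m -> r' != r ->
  branch_mult V (F r') != 0.
Proof.
move=> Vr rm cV r'm ne; rewrite eq_sym in ne.
have [t [tr tr' e]] := meet_ex rm r'm ne.
have rt : branch_mult (F r) (F t) != 0 by rewrite Br // tr oner_eq0.
have [[r1 [r1r]]|] := triple_dichotomy xk yk (subxx _) (isoproj3_neq0 Vr rt).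
  have [s es] := ex_label r1 (leqnn _); rewrite {r1}es in r1r *.
  rewrite !Fc // cV !intB e => /intr_inj es /down_of_triple[Vs ts].
  suff -> : r' = s by [].
  by apply: up_inj tr' ts _; move: es => /(canRL (subrK _)); rewrite subrK.
rewrite !Fc // cV !intB e -[1]/(1%:~R) -[- 1%:~R]/((-1)%:~R) => -[_ h].
have g1 := up_gap tr' tr; have g2 := up_gap tr tr'.
case: h => /intr_inj h; [case/eqP: g1 | case/eqP: g2]; lia.
Qed.

(** The transposition is not in [G k.+1], hence the element [f] has no component on
    the identity and its trace in the regular representation is zero. In [V] this
    trace is computed by [triple_swap]. *)
Lemma trace_sum (r : intpart k.+1) (t : intpart k) : t ≺ r ->
  \sum_(V : Iirr (G k.+2))
    'chi_V 1%g * branch_mult V (F r) / (irr_content V - ct r - (ct r - ct t)) = 0.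
Proof.
move=> tr; have rt : branch_mult (F r) (F t) = 1 by rewrite Br // tr.
have sG : tperm x y \in G k.+2 by apply: tperm_fixer; rewrite ?xk ?yk.
pose f := gconv (gdelta (tperm x y)) (gconv (isoidem (F r)) (isoidem (F t))).
have f1 : f 1%g = 0.
  rewrite /f {1}/gconv (bigD1 (tperm x y)) //= big1 ?addr0 => [|z /negPf zs]; last first.
    by rewrite /gdelta zs mul0r.
  rewrite mulg1 (supp_gconv (supp_isoidem (F r))) ?mulr0 //.
    exact: supp_sub (fixer_subS N k) (supp_isoidem _).
  rewrite groupV; apply/fixerP => /(_ y); rewrite yk leqnn tpermR => /(_ isT) e.
  by have := congr1 val e; rewrite /= xk yk; lia.
transitivity (('chi_(F t) 1%g)^-1 *
    \sum_(V : Iirr (G k.+2)) 'chi_V 1%g * \tr (gact 'Chi_V f)); last first.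
  by rewrite mxtrace_gact_reg f1 !mulr0.
rewrite mulr_sumr; apply: eq_bigr => V _; have kG : G k.+1 \subset G k.+2 := fixer_subS N _.
have -> : \tr (gact 'Chi_V f) =
    branch_mult V (F r) * 'chi_(F t) 1%g / (irr_content V - ct r - (ct r - ct t)).
  pose Q := isoproj 'Chi_V (F r) *m isoproj 'Chi_V (F t).
  have opf : gact 'Chi_V f = 'Chi_V (tperm x y) *m Q.
    rewrite /f gact_gconv ?gact_gdelta //; last exact: supp_gdelta.
    by rewrite gact_gconv //; apply: supp_sub (supp_isoidem _).
  have trQ : \tr Q = branch_mult V (F r) * 'chi_(F t) 1%g.
    by rewrite mxtrace_isoproj3 ?fixer_subS // rt mul1r.
  rewrite opf; have [V0|V0] := eqVneq (branch_mult V (F r)) 0.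
    have : Q = 0; last by move->; rewrite mulmx0 mxtrace0 V0 !mul0r.
    rewrite /Q; apply/eqP; suff -> : isoproj 'Chi_V (F r) = 0 by rewrite mul0mx.
    by apply/eqP; rewrite isoproj_eq0 // irrRepr; apply/eqP.
  have rt0 : branch_mult (F r) (F t) != 0 by rewrite rt oner_eq0.
  have := triple_swap 'Chi_V xk yk (subxx _) V (F t) (F r) (F r).
  have := triple_neq xk yk (subxx _) (isoproj3_neq0 V0 rt0).
  have := triple_mul 'Chi_V (subxx _) V (F t) (F r) (F r).
  rewrite isoproj_irr !eqxx !mul1mx !scale1r -/Q !Fc // => QQ n0 sw.
  have e : \tr Q = (irr_content V - ct r - (ct r - ct t)) * \tr ('Chi_V (tperm x y) *m Q).
    by rewrite -{1}sw mxtraceZ -mulmxA mxtrace_mulC -mulmxA QQ.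
  by rewrite -trQ e mulrAC mulfV ?mul1r ?subr_eq0.
move: (irr1_neq0 (F t)) (_ - _)^-1 => n0 c; by field.
Qed.

Let A (r : intpart k.+1) := [set t : intpart k | t ≺ r].
Let I (r : intpart k.+1) := [set V : Iirr (G k.+2) | branch_mult V (F r) != 0].

Let branch_mult_ge1 (V : Iirr (G k.+2)) (r : intpart k.+1) : V \in I r -> 1 <= branch_mult V (F r).
Proof.
by rewrite inE; have /natrP[m ->] := branch_mult_nat V (F r); rewrite pnatr_eq0 ler1n lt0n.
Qed.

Let gram_part (r r' : intpart k.+1) :
  \sum_(V : Iirr (G k.+2)) branch_mult V (F r) * branch_mult V (F r') =
  (r == r')%:R + \sum_(t : intpart k) ((t ≺ r) && (t ≺ r'))%:R.
Proof.
rewrite (gram_branch_mult _ _ xk yk) (part_irr_eq _ _ (Lev (leqnn _))).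
rewrite (sum_part_irr _ (Lev (leqnSn _))).
congr (_ + _).
by apply: eq_bigr => t _; rewrite !Br // mulr_natl mulrb; case: (_ ≺ _).
Qed.

Let norm_part (r : intpart k.+1) : \sum_(V in I r) branch_mult V (F r) ^+ 2 = (#|A r|.+1)%:R.
Proof.
have := gram_part r r; rewrite eqxx (bigID (mem (I r))) /= [X in _ + X]big1 ?addr0.
  move=> e; under eq_bigr do rewrite expr2; rewrite e -[#|A r|.+1]add1n natrD; congr (_ + _).
  rewrite -sum1_card natr_sum [RHS]big_mkcond; apply: eq_bigr => t _.
  by rewrite andbb inE; case: (_ ≺ _).
by move=> V; rewrite inE negbK => /eqP->; rewrite mul0r.
Qed.

(** The squares of the multiplicities add up to [#|A r|.+1], while by the Cauchy
    argument there are more than [#|A r|] values of [irr_content]: each multiplicity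
    is one and [irr_content] separates the constituents. These values are
    contents of cells that can be added, and by [card_up_le] there are no more
    than [#|A r|.+1] of those. *)
Lemma constituents (r : intpart k.+1) :
  [/\ forall V : Iirr (G k.+2), branch_mult V (F r) != 0 -> branch_mult V (F r) = 1,
      forall V V' : Iirr (G k.+2), branch_mult V (F r) != 0 -> branch_mult V' (F r) != 0 ->
        irr_content V = irr_content V' -> V = V' &
      forall m : intpart k.+2, r ≺ m ->
        exists2 V : Iirr (G k.+2), branch_mult V (F r) != 0 & irr_content V = ct m].
Proof.
have I0 : I r != set0.
  apply/eqP => e; have := norm_part r; rewrite e big_set0 => /esym/eqP.
  by rewrite pnatr_eq0.
have IA : (#|I r| <= #|A r|.+1)%N.
  rewrite -(ler_nat algC) -norm_part -sumr_const ler_sum // => V /branch_mult_ge1.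
  exact: exprn_ege1.
pose bv (V : Iirr (G k.+2)) : algC := irr_content V - ct r.
have AI : (#|A r| < size (undup [seq bv V | V in I r]))%N.
  apply: (@cauchy_count _ _ _ _ (fun V => 'chi_V 1%g * branch_mult V (F r)) _
                       (fun t : intpart k => ct r - ct t)) => //.
  - move=> t t'; rewrite !inE => tr tr' /addrI/oppr_inj/intr_inj.
    exact: down_inj tr tr'.
  - by move=> V /branch_mult_ge1 h; rewrite mulr_gt0 ?irr1_gt0 // (lt_le_trans ltr01).
  - move=> V t; rewrite !inE => V0 tr.
    have rt0 : branch_mult (F r) (F t) != 0 by rewrite Br // tr oner_eq0.
    by have := triple_neq xk yk (subxx _) (isoproj3_neq0 V0 rt0); rewrite !Fc.
  move=> t; rewrite inE => tr; rewrite -[RHS](trace_sum tr) [RHS](bigID (mem (I r))) /=.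
  rewrite [X in _ = _ + X]big1 ?addr0 // => V; rewrite inE negbK => /eqP->.
  by rewrite mulr0 mul0r.
have szI : size [seq bv V | V in I r] = #|I r| by rewrite size_map cardE.
have cI : #|I r| = #|A r|.+1.
  apply/eqP; rewrite eqn_leq IA (leq_trans AI) // -szI; exact: size_undup.
have /dinjectiveP inj : dinjectiveb bv (I r).
  rewrite /dinjectiveb; apply: contraTT AI => nu.
  by rewrite -leqNgt -ltnS -cI -szI ltn_size_undup.
have inj' V V' : V \in I r -> V' \in I r -> irr_content V = irr_content V' -> V = V'.
  by move=> VI V'I e; apply: inj => //; rewrite /bv e.
split.
- move=> V V0; have VI : V \in I r by rewrite inE.
  have /eqP : \sum_(W in I r) (branch_mult W (F r) ^+ 2 - 1) = 0.
    by rewrite sumrB norm_part sumr_const cI subrr.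
  rewrite psumr_eq0 => [/allP/(_ V)|W /branch_mult_ge1 h]; last by rewrite subr_ge0 exprn_ege1.
  rewrite mem_index_enum VI => /(_ isT); rewrite subr_eq0 sqrf_eq1 => /orP[/eqP//|/eqP e].
  by have := lt_le_trans ltr01 (branch_mult_ge1 VI); rewrite e oppr_gt0 ltr10.
- by move=> V V' V0 V'0; apply: inj'; rewrite inE.
pose U := [set m : intpart k.+2 | r ≺ m].
pose h (V : Iirr (G k.+2)) := [pick m : intpart k.+2 | (r ≺ m) && (irr_content V == ct m)].
have hP (V : Iirr (G k.+2)) : V \in I r ->
    exists m : intpart k.+2, [/\ h V = Some m, r ≺ m & irr_content V = ct m].
  rewrite inE => V0; have [m rm em] := content_addable V0.
  rewrite /h; case: pickP => [m' /andP[? /eqP ?]|/(_ m)]; first by exists m'.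
  by rewrite rm em eqxx.
have hinj : {in I r &, injective h}.
  move=> V V' /[dup] VI /hP[m [-> _ e]] /[dup] V'I /hP[m' [-> _ e']] [em].
  by apply: inj' => //; rewrite e e' em.
have hU : h @: I r = Some @: U.
  apply/eqP; rewrite eqEcard; apply/andP; split.
    apply/subsetP => o /imsetP[V /hP[m [-> rm _]] ->].
    by apply/imsetP; exists m; rewrite ?inE.
  rewrite (card_in_imset hinj) (card_imset _ Some_inj) cI; exact: card_up_le.
move=> m rm; have : Some m \in h @: I r by rewrite hU imset_f // inE.
case/imsetP=> V VI e; have [m' [e' _ em]] := hP _ VI.
by exists V; [move: VI; rewrite inE | move: e; rewrite e' => -[->]].
Qed.

(** Suppose that [V] contains [r'] as well, with [r'] not below [m]. The two share a
    diagram below them, so they have a common upper bound [m']; the character found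
    for [m'] contains both and must be [V], as the induced characters of [r] and [r']
    have inner product at most one. Then [m = m'] by the content. *)
Lemma branching (V : Iirr (G k.+2)) (r : intpart k.+1) (m : intpart k.+2) :
    branch_mult V (F r) != 0 -> r ≺ m -> irr_content V = ct m ->
  forall r' : intpart k.+1, branch_mult V (F r') = (r' ≺ m)%:R.
Proof.
have down := content_down.
move=> Vr rm cV r'; have [one _ _] := constituents r'.
have [->|ne] := eqVneq r' r; first by rewrite rm; have [h _ _] := constituents r; apply: h.
have [r'm|r'm] := boolP (r' ≺ m); first by apply: one; apply: down rm cV r'm ne.
apply/eqP; apply: contraNT r'm => V0; rewrite eq_sym in ne.
have pos (W : Iirr (G k.+2)) s : 0 <= branch_mult W (F s) by rewrite natr_ge0 // branch_mult_nat.
have := gram_part r r'; rewrite (negPf ne) add0r => S.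
have [t /andP[tr tr']] : exists t : intpart k, (t ≺ r) && (t ≺ r').
  apply/existsP; apply: contraT => /existsPn no.
  have /eqP : \sum_(W : Iirr (G k.+2)) branch_mult W (F r) * branch_mult W (F r') = 0.
    by rewrite S big1 // => t _; rewrite (negPf (no t)).
  rewrite psumr_eq0 => [/allP/(_ V)|W _]; last by rewrite mulr_ge0 ?pos.
  by rewrite mem_index_enum mulf_eq0 (negPf Vr) (negPf V0) => /(_ isT).
(* The common upper bound competing with [m]. *)
have [m' [rm' r'm' _]] := join_ex tr tr' ne.
have [_ inj ex] := constituents r; have [V' V'r eV'] := ex m' rm'.
have V'r' : branch_mult V' (F r') != 0 by apply: down V'r rm' eV' r'm' _; rewrite eq_sym.
suff VV : V = V'.
  have -> // : m = m' by apply: up_inj rm rm' _; apply/(@intr_inj algC); rewrite -cV VV eV'.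
apply/eqP; apply: contraT => VV; move: S.
rewrite (bigD1 t) //= tr tr' [X in _ = _ + X]big1 ?addr0 => [|s]; last first.
  move=> st; case: (boolP (_ && _)) => // /andP[sr sr'].
  by move: st; rewrite (meet_uniq ne sr sr' tr tr') eqxx.
rewrite (bigD1 V) //= (bigD1 V') /=; last by rewrite eq_sym.
rewrite addrA => S; have : (1 + 1 : algC) <= 1.
  rewrite -[leRHS]S -[leLHS]addr0; apply: lerD; last first.
    by apply: sumr_ge0 => W _; rewrite mulr_ge0 ?pos.
  by apply: lerD; rewrite -[leLHS]mulr1; apply: ler_pM => //; apply: branch_mult_ge1; rewrite inE.
by rewrite gerDl ler10.
Qed.

Lemma labelled_step : labelled N k.+2 /\ branches N k.+1.
Proof.
have spec (m : intpart k.+2) : irr_content (part_irr N m) = ct m /\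
    forall r : intpart k.+1, branch_mult (part_irr N m) (F r) = (r ≺ m)%:R.
  have [r rm] := removable_ex m; have [_ _ /(_ m rm)[V Vr cV]] := constituents r.
  have b := branching Vr rm cV.
  rewrite /= ; case: pickP => [i /andP[/eqP ? /forallP h]|/(_ V)] /=.
    by split=> // s; apply/eqP/h.
  by rewrite cV eqxx /= => /forallP[]; move=> s; rewrite b.
split; last by move=> r m; case: (spec m).
split=> [m m' e|V|m]; last by case: (spec m).
  have [c b] := spec m; have [c' b'] := spec m'; have [r rm] := removable_ex m.
  have rm' : r ≺ m'.
    by have := b r; rewrite e b' rm => /eqP; rewrite eqr_nat eqb1.
  by apply: up_inj rm rm' _; apply/(@intr_inj algC); rewrite -c -c' e.
have [r Vr] : exists r : intpart k.+1, branch_mult V (F r) != 0.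
  apply/existsP; apply: contraT => /existsPn no.
  have e0 : 'Res[G k.+1] 'chi_V = 0.
    rewrite [LHS]cfun_sum_cfdot big1 // => i _; have [s ->] := ex_label i (leqnn _).
    by have := no s; rewrite negbK => /eqP; rewrite /branch_mult => ->; rewrite scale0r.
  have /eqP := congr1 (fun phi : 'CF(_) => phi 1%g) e0.
  by rewrite cfRes1 cfunE (negPf (irr1_neq0 V)).
have [m rm cV] := content_addable Vr.
have [cm bm] := spec m; have [_ inj _] := constituents r.
exists m; apply: inj; rewrite ?cm ?cV // bm rm oner_eq0 //.
Qed.

End Step.

Section Base.
Variable N : nat.
Local Notation G := (@fixer N).

Lemma fixer_le1 k : (k <= 1)%N -> G k = 1%G.
Proof.
move=> k1; apply/trivGP/subsetP => g /fixerP gk; rewrite inE; apply/eqP/permP => i.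
rewrite perm1; have [/gk //|ik] := leqP k i.
have i0 : i = 0%N :> nat by lia.
apply: ord_inj; apply/eqP; rewrite i0 -leqn0 leqNgt; apply/negP => gi0.
have /perm_inj e : g (g i) = g i by apply: gk; lia.
by move: gi0; rewrite e i0.
Qed.

Lemma irr_trivial (H : {group 'S_N}) (i : Iirr H) : H = 1%G -> i = 0.
Proof.
move=> H1; apply: irr_inj; rewrite irr0; apply/cfun_inP => g; rewrite {1}H1 => /set1P->.
have /char_abelianP/(_ i) : abelian H by rewrite H1 abelian1.
by move/lin_char1->; rewrite cfun1E group1.
Qed.

Lemma intpart_small k (s : intpart k) : (k <= 1)%N -> rows s = nseq k 1%N.
Proof.
move=> k1; have := intpartP s; have := is_part_size (intpartP s); case: (rows s) => [|a [|b l]].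
- by move=> _ /and3P[_ _ /eqP/= <-].
- by move=> _ /and3P[_ a0 /eqP/=]; rewrite addn0 => ak; rewrite {a}ak in a0 *; case: k k1 a0 {s} => [|[]].
by move=> h _; have := leq_trans h k1.
Qed.

Lemma intpart_small_ex k : (k <= 1)%N -> exists s : intpart k, True.
Proof.
move=> k1; have h : is_part k (nseq k 1%N) by case: k k1 => [|[]].
by exists (Intpart h).
Qed.

Lemma labelled_small k : (k <= 1)%N -> labelled N k.
Proof.
move=> k1; split=> [s t _|i|s]; first by apply: val_inj; rewrite /= !intpart_small.
  have [s _] := intpart_small_ex k1; exists s.
  by transitivity (0 : Iirr (G k)); [|apply/esym]; apply: irr_trivial (fixer_le1 k1).
have -> : cont_sum s = 0.
  rewrite /cont_sum intpart_small //; case: k k1 {s} => [|[|//]] _; first by rewrite big_ord0.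
  by rewrite big_ord_recl big_ord0 /= big_ord_recl big_ord0.
rewrite /irr_content big_pred0 ?mul0r // => -[a b]; apply/negP => /and3P[/= a1 b1].
by rewrite -val_eqE /=; lia.
Qed.

Lemma branches0 : branches N 0.
Proof.
move=> r m; have -> : r ≺ m by apply/existsP; exists ord0; rewrite !intpart_small.
have e (i : Iirr (G 0)) : 'chi_i = 1 by rewrite (irr_trivial i (fixer_le1 _)) ?irr0.
have e1 (i : Iirr (G 1)) : 'chi_i = 1 by rewrite (irr_trivial i (fixer_le1 _)) ?irr0.
by rewrite /branch_mult e e1 cfRes_cfun1 ?fixer_sub // cfnorm1.
Qed.

Theorem labelled_branches k : (k <= N)%N -> labelled N k /\ forall j, (j < k)%N -> branches N j.
Proof.
elim/ltn_ind: k => -[|[|k]] IH kN.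
- by split=> //; apply: labelled_small.
- by split=> [|[|//] _]; [apply: labelled_small | apply: branches0].
have k1N : (k < N)%N by apply: ltnW.
have [L B] := @labelled_step N k (Ordinal k1N) (Ordinal kN) erefl erefl
  (fun j jk => proj1 (IH j jk (leq_trans jk k1N))) (fun j jk => proj2 (IH k.+1 (ltnSn _) k1N) j jk).
split=> // j; rewrite ltnS leq_eqVlt => /predU1P[->//|jk].
exact: (proj2 (IH k.+1 (ltnSn _) k1N)).
Qed.
End Base.

(** * Young bases *)

Section YoungBasis.
Variable N : nat.
Local Notation G := (@fixer N).
Local Notation ct s := (cont_sum s)%:~R.

(** A version of [part_irr] on lists, to be used with chains. *)
Definition rows_irr k (s : seq nat) : Iirr (G k) :=
  if insub s is Some p then @part_irr N k p else 0.

Lemma rows_irrE k (p : intpart k) : rows_irr k p = part_irr N p.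
Proof. by rewrite /rows_irr valK. Qed.

Let lev k : (k <= N)%N -> labelled N k. Proof. by case/labelled_branches. Qed.
Let br k : (k < N)%N -> branches N k. Proof. by case/labelled_branches => _; apply. Qed.

Lemma rows_content k s : (k <= N)%N -> is_part k s -> irr_content (rows_irr k s) = ct s.
Proof.
by move=> kN ps; rewrite -[s]/(rows (Intpart ps)) rows_irrE; case: (lev kN).
Qed.

Lemma rows_branch k s t : (k < N)%N -> is_part k s -> is_part k.+1 t ->
  branch_mult (rows_irr k.+1 t) (rows_irr k s) = (s ≺ t)%:R.
Proof.
move=> kN ps pt; rewrite -[s]/(rows (Intpart ps)) -[t]/(rows (Intpart pt)) !rows_irrE.
exact: br.
Qed.

Lemma rows_irr_eq k s t : (k <= N)%N -> is_part k s -> is_part k t ->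
  (rows_irr k s == rows_irr k t) = (s == t).
Proof.
move=> kN ps pt; rewrite -[s]/(rows (Intpart ps)) -[t]/(rows (Intpart pt)) !rows_irrE.
by rewrite part_irr_eq //; apply: lev.
Qed.

(** The product of the idempotents along the chain, from the top down. *)
Fixpoint chain_id (c : nat -> seq nat) k : 'S_N -> algC :=
  if k is k'.+1 then gconv (isoidem (rows_irr k (c k))) (chain_id c k')
  else isoidem (rows_irr 0 (c 0)).

Lemma supp_chain_id c k : supp (G k) (chain_id c k).
Proof.
elim: k => [|k IHk] /=; first exact: supp_isoidem.
by apply: supp_gconv; [apply: supp_isoidem | apply: supp_sub IHk; apply: fixer_subS].
Qed.

Section Rep.
Variables (H : {group 'S_N}) (d : nat) (rG : mx_representation algC H d).
Local Notation E k s := (isoproj rG (rows_irr k s)).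
Local Notation P c k := (gact rG (chain_id c k)).

Lemma chain_gactS c k : G k.+1 \subset H -> P c k.+1 = E k.+1 (c k.+1) *m P c k.
Proof. by move=> kH; rewrite /= gact_gconv //; apply: supp_sub kH (supp_isoidem _). Qed.

Lemma chain_absorb c k : G k \subset H -> E k (c k) *m P c k = P c k.
Proof.
case: k => [|k] kH; first by rewrite isoproj_idem.
by rewrite chain_gactS // mulmxA isoproj_idem.
Qed.

Lemma chain_mul c c' k : G k \subset H ->
  P c k *m P c' k = if [forall j : 'I_k.+1, rows_irr j (c j) == rows_irr j (c' j)]
                    then P c k else 0.
Proof.
elim: k => [|k IHk] kH.
  rewrite [LHS]isoproj_mul //; case: forallP => h.
    by rewrite (h ord0) scale1r.
  case: eqP => e; last by rewrite scale0r.
  by case: h => j; rewrite ord1 /= e.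
have kH' := subset_trans (fixer_subS N k) kH.
rewrite !chain_gactS // mulmxA -(mulmxA _ (P c k)).
rewrite -isoproj_gact_comm //; last exact: supp_sub (fixer_subS N k) (@supp_chain_id c k).
rewrite mulmxA -mulmxA isoproj_mul // IHk //.
case: (boolP [forall j : 'I_k.+2, _]) => [/forallP h|/forallPn[j]].
  have /= -> := h ord_max; rewrite scale1r.
  have -> // : [forall j : 'I_k.+1, rows_irr j (c j) == rows_irr j (c' j)].
  by apply/forallP => j; have := h (widen_ord (leqnSn _) j).
move=> nj; have [jk|kj] := ltnP j k.+1.
  case: forallP => [/(_ (Ordinal jk)) /= h|_]; last by rewrite mulmx0.
  by rewrite h in nj.
have jk : j = k.+1 :> nat by apply/eqP; rewrite eqn_leq kj -ltnS ltn_ord.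
move: nj; rewrite jk => /negPf->.
by rewrite scale0r mul0mx.
Qed.

Lemma chain_gact_idem c k : G k \subset H -> P c k *m P c k = P c k.
Proof. by move=> kH; rewrite chain_mul //; case: forallP => // -[]. Qed.

Lemma chain_jm c k (x : 'I_N) : G k \subset H -> (k <= N)%N -> chain k c -> (x < k)%N ->
  P c k *m jm_mx rG x = (ct (c x.+1) - ct (c x)) *: P c k.
Proof.
elim: k => // k IHk kH kN hc; rewrite ltnS leq_eqVlt => /predU1P[xk|xk]; last first.
  have hc' : chain k c by case: hc => pc ac; split=> j jk; [apply: pc | apply: ac]; apply: leqW.
  rewrite chain_gactS // -mulmxA IHk ?scalemxAr //; last exact: ltnW.
  exact: subset_trans (fixer_subS N k) kH.
have kH' := subset_trans (fixer_subS N k) kH; have [pc ac] := hc.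
rewrite chain_gactS // -(chain_absorb c kH') -!mulmxA.
have -> : P c k *m jm_mx rG x = jm_mx rG x *m P c k.
  apply/esym/(gact_comm kH' (@supp_chain_id c k)) => g gk; exact: jm_comm xk kH gk.
rewrite !mulmxA isoproj_jm // -scalemxAl xk !rows_content //; try exact: ltnW.
  exact/pc/leqnSn.
exact: pc.
Qed.
End Rep.

Lemma irr0_deg (i : Iirr (G 0)) : 'chi_i 1%g = 1.
Proof.
have -> : i = 0 by apply: (irr_trivial i); apply: fixer_le1.
by rewrite irr0 cfun1E group1.
Qed.

(** Branching is multiplicity free, so each step of the chain contributes a factor
    one. *)
Lemma chain_trace (H : {group 'S_N}) d (rG : mx_representation algC H d) c k :
    G k \subset H -> (k <= N)%N -> chain k c ->
  \tr (gact rG (chain_id c k)) = '['Res[G k] (cfRepr rG), 'chi_(rows_irr k (c k))].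
Proof.
elim: k H d rG => [|k IHk] H d rG kH kN hc.
  by rewrite [LHS]mxtrace_isoproj // irr0_deg mulr1.
have hc' : chain k c by case: hc => pc ac; split=> j jk; [apply: pc | apply: ac]; apply: leqW.
have [pc ac] := hc.
rewrite /= mxtrace_isoidem //; last exact: supp_sub (fixer_subS N k) (@supp_chain_id c k).
rewrite IHk ?fixer_subS ?(ltnW kN) // irrRepr.
have := rows_branch kN (pc _ (leqnSn _)) (pc _ (leqnn _)); rewrite ac // /branch_mult => ->.
by rewrite mulr1.
Qed.

(** The projectors of each level add up to one, and only those below [s] have a
    nonzero product with that of [s]. *)
Lemma chain_span (H : {group 'S_N}) d (rG : mx_representation algC H d) m
    (S : 'M_(m, d)) k (Q : 'M_d) s :
    G k \subset H -> (k <= N)%N -> is_part k s ->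
    (forall c, chain k c -> c k = s -> (Q *m gact rG (chain_id c k) <= S)%MS) ->
  (Q *m isoproj rG (rows_irr k s) <= S)%MS.
Proof.
elim: k Q s => [|k IHk] Q s kH kN ps hS.
  have := hS (fun=> s); rewrite /=; apply=> //; split=> // j; rewrite leqn0 => /eqP->//.
have kH' := subset_trans (fixer_subS N k) kH.
rewrite -[isoproj rG _]mulmx1 -(isoproj_sum rG kH') !mulmx_sumr.
apply: summx_sub => i _; have [_ /(_ i)[t <-] _] := lev (ltnW kN); rewrite -rows_irrE mulmxA.
have pt := intpartP t; have [ts|ts] := boolP (t ≺ s); last first.
  rewrite -mulmxA isoproj2_eq0 ?fixer_subS ?mulmx0 ?sub0mx //.
  by rewrite rows_branch // (negPf ts).
apply: (IHk) => //; first exact: ltnW.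
(* The chain [c] followed by [s]. *)
move=> c [pc ac] ck; pose c' j := if (j <= k)%N then c j else s.
have e : gact rG (chain_id c' k) = gact rG (chain_id c k).
  suff h j : (j <= k)%N -> chain_id c' j = chain_id c j by rewrite h.
  elim: j => [|j IHj] jk; first by rewrite /= /c'.
  by rewrite /= IHj ?(ltnW jk) // /c' jk.
have := hS c'; rewrite chain_gactS // e /c' ltnn mulmxA; apply=> //.
split=> j jk /=; last first.
  have [->|ne] := eqVneq j k; first by rewrite leqnn ltnn ck.
  have {jk ne} jk : (j < k)%N by rewrite ltn_neqAle ne -ltnS.
  by rewrite (ltnW jk) jk ac.
case: leqP => jk'; first exact: pc.
by have -> : j = k.+1 by apply/eqP; rewrite eqn_leq jk.
Qed.


(** By induction [v] lies in the component of [c k]. Its component on a diagram [m]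
    is zero unless [m] is above [c k], and then the eigenvalue at [k] forces
    [m = c k.+1] by [up_inj]. *)
Lemma joint_eigenvector (H : {group 'S_N}) d (rG : mx_representation algC H d) c k
    (v : 'rV_d) : G k \subset H -> (k <= N)%N -> chain k c ->
    (forall x : 'I_N, (x < k)%N -> v *m jm_mx rG x = (ct (c x.+1) - ct (c x)) *: v) ->
  v *m isoproj rG (rows_irr k (c k)) = v.
Proof.
elim: k => [|k IHk] kH kN hc hv.
  rewrite -[RHS]mulmx1 -(isoproj_sum rG kH) (bigD1 (rows_irr 0 (c 0))) //= big1 ?addr0 // => i.
  have e j : j = 0 :> Iirr (G 0) by apply: (irr_trivial j); apply: fixer_le1.
  by rewrite (e i) (e (rows_irr _ _)) eqxx.
have kH' := subset_trans (fixer_subS N k) kH; have [pc ac] := hc.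
have hc' : chain k c by split=> j jk; [apply: pc | apply: ac]; apply: leqW.
have vE : v *m isoproj rG (rows_irr k (c k)) = v.
  by apply: IHk => // [|x xk]; [apply: ltnW | apply: hv; apply: leqW].
pose x := Ordinal kN; have xk : x = k :> nat by [].
rewrite -[RHS]mulmx1 -(isoproj_sum rG kH) (bigD1 (rows_irr k.+1 (c k.+1))) //= mulmxDr.
rewrite [X in _ = _ + X]mulmx_sumr [X in _ = _ + X]big1 ?addr0 // => i.
have [_ /(_ i)[m <-] _] := lev kN; rewrite -rows_irrE => ne.
apply/eqP; apply: contraR ne => n0.
have pk := pc _ (leqnSn k); have pk1 := pc _ (leqnn _).
have km : c k ≺ m.
  apply: contraR n0 => km; rewrite -vE -mulmxA.
  rewrite -(isoproj_isoproj_comm rG _ _ (fixer_subS N k) kH) isoproj2_eq0 ?fixer_subS ?mulmx0 //.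
  by rewrite rows_branch // (negPf km).
have e1 : v *m isoproj rG (rows_irr k.+1 m) *m jm_mx rG x =
    (ct (c k.+1) - ct (c k)) *: (v *m isoproj rG (rows_irr k.+1 m)).
  by rewrite -mulmxA -jm_isoproj_comm_lt // mulmxA hv // -scalemxAl.
have e2 : v *m isoproj rG (rows_irr k.+1 m) *m jm_mx rG x =
    (ct m - ct (c k)) *: (v *m isoproj rG (rows_irr k.+1 m)).
  rewrite -{1}vE -(mulmxA v) -(isoproj_isoproj_comm rG _ _ (fixer_subS N k) kH) -mulmxA isoproj_jm //.
  rewrite !rows_content ?(ltnW kN) // -scalemxAr; congr (_ *: _).
  by rewrite (isoproj_isoproj_comm rG _ _ (fixer_subS N k) kH) mulmxA vE.
have /eqP := e1; rewrite e2 -subr_eq0 -scalerBl scalemx_eq0 (negPf n0) orbF subr_eq0.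
move/eqP/addIr/intr_inj => e; apply/eqP; congr rows_irr.
have := @up_inj k (Intpart pk) m (Intpart pk1) km; rewrite /= ac // => /(_ isT e) ->.
by [].
Qed.

(** Same as [has_young_basis], for representations of arbitrary subgroups. *)
Definition young_basis (H : {group 'S_N}) (mu : intpart N) d
    (rG : mx_representation algC H d) : Prop :=
  exists v : syt mu -> 'rV[algC]_d,
    basis_of fullv [seq v T | T : syt mu] /\
    forall (T : syt mu) (i : 'I_N), v T *m jm_mx rG i = (syt_content T i)%:~R *: v T.

Lemma young_basis_syt (H : {group 'S_N}) (mu : intpart N) d (rG : mx_representation algC H d)
    (v : syt mu -> 'rV[algC]_d) :
  (0 < d)%N -> basis_of fullv [seq v T | T : syt mu] -> exists T, v T != 0.
Proof.
move=> d0 /andP[/eqP sp fr]; case: (pickP (fun T : syt mu => true)) => [T _|no].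
  by exists T; apply: (free_not0 fr); apply/imageP; exists T.
have X0 : [seq v T | T : syt mu] = [::].
  by apply: size0nil; rewrite size_map -cardE; apply: eq_card0.
have := memvf (const_mx 1 : 'rV[algC]_d); rewrite -sp X0 span_nil memv0 => /eqP/rowP/(_ (Ordinal d0)).
by rewrite !mxE => /eqP; rewrite oner_eq0.
Qed.

Lemma young_basis_uniq (mu : intpart N) (i : Iirr (G N)) :
  young_basis mu 'Chi_i -> i = part_irr N mu.
Proof.
case=> v [vb vjm]; have [|T T0] := young_basis_syt 'Chi_i _ vb; first exact: irr_degree_gt0.
have [c [hc cN _ cE]] := syt_chain_ex (valP T).
have := @joint_eigenvector _ _ 'Chi_i c N (v T) (subxx _) (leqnn _) hc.
rewrite cN rows_irrE isoproj_irr => h; apply/eqP; apply: contraNT T0 => /negPf ne.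
apply/eqP; rewrite -h ?ne ?raddf0 ?mulmx0 // => x _.
by rewrite vjm -intrB cE.
Qed.

(** The image of the projector of a chain is a line. The lines of the different
    chains are independent, since the projectors are orthogonal, and they span by
    [chain_span]. *)
Lemma young_basis_ex (mu : intpart N) : young_basis mu 'Chi_(part_irr N mu).
Proof.
set i := part_irr N mu; pose P c := gact 'Chi_i (chain_id c N).
have rkP c : chain N c -> c N = mu -> \rank (P c) = 1%N.
  move=> hc cN; apply/eqP; rewrite -(eqr_nat algC) -mxtrace_idem; last exact: chain_gact_idem.
  by rewrite chain_trace // cN rows_irrE irrRepr cfRes_id cfdot_irr eqxx.
have [c cP] := fin_all_exists (fun T : syt mu => syt_chain_ex (valP T)).
pose v T := nz_row (P (c T)).
have vP T : v T *m P (c T) = v T.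
  have /submxP[w ->] : (v T <= P (c T))%MS by apply: nz_row_sub.
  by rewrite -mulmxA chain_gact_idem.
have v0 T : v T != 0.
  rewrite nz_row_eq0 -mxrank_eq0 rkP //; by case: (cP T).
have vjm T (x : 'I_N) : v T *m jm_mx 'Chi_i x = (syt_content T x)%:~R *: v T.
  have [hc _ _ cE] := cP T; rewrite -{1}vP -mulmxA chain_jm // -scalemxAr vP.
  by rewrite -intrB cE.
have orth T T' : T != T' -> v T *m P (c T') = 0.
  move=> ne; rewrite -vP -mulmxA chain_mul //; case: forallP => [h|_]; last by rewrite mulmx0.
  case/eqP: ne; apply: chain_inj => j r jN.
  have [hc _ rE _] := cP T; have [hc' _ rE' _] := cP T'.
  rewrite -rE -rE'; congr (nth _ _ r); apply/eqP; rewrite -(@rows_irr_eq j) //.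
  - by have := h (Ordinal (jN : (j < N.+1)%N)).
  - by case: hc => pc _; apply: pc.
  by case: hc' => pc _; apply: pc.
exists v; split=> //; apply/andP; split; last first.
  rewrite /image_mem; elim: (enum _) (enum_uniq (syt mu)) => [|T L IHL] /=; first by rewrite nil_free.
  case/andP=> TL /IHL fL; rewrite free_cons fL andbT; apply/negP => vL.
  have e := coord_span (vL : v T \in <<in_tuple [seq v T | T <- L]>>%VS).
  have : v T *m P (c T) == 0; last by rewrite vP (negPf (v0 T)).
  rewrite {1}e mulmx_suml big1 // => j _.
  have jL : (j < size L)%N by rewrite -[ltnRHS](size_map v) ltn_ord.
  rewrite -scalemxAl (nth_map T) // orth ?scaler0 //.
  by apply: contraNneq TL => <-; apply: mem_nth.
rewrite eqEsubv subvf /=; apply/subvP => u _.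
pose S := \matrix_(j < #|{: syt mu}|) v (enum_val j).
have vS T : (v T <= S)%MS.
  have -> : v T = row (enum_rank T) S by rewrite rowK enum_rankK.
  exact: row_sub.
have : (1%:M *m isoproj 'Chi_i (rows_irr N mu) <= S)%MS.
  apply: chain_span => // c' hc' c'N; rewrite mul1mx.
  have [T TE] := chain_syt_ex hc' c'N; have [hc cN _ cE] := cP T.
  have e : P c' = P (c T).
    have e j : (j <= N)%N -> c' j = c T j.
      apply: chain_eq hc' hc _ j => j jN.
      by have := TE (Ordinal jN); have := cE (Ordinal jN) => /= -> ->.
    rewrite /P; suff h j : (j <= N)%N -> chain_id c' j = chain_id (c T) j by rewrite h.
    by elim: j => [|j IHj] jN /=; rewrite e // IHj // ltnW.
  rewrite -/(P c') e; apply: submx_trans (vS T).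
  rewrite -(geq_leqif (mxrank_leqif_sup (nz_row_sub _))) rkP // lt0n mxrank_eq0; exact: v0.
rewrite rows_irrE isoproj_irr eqxx mulmx1 => /(submx_trans (submx1 u))/submxP[w ->].
rewrite mulmx_sum_row; apply: memv_suml => j _; apply: memvZ; rewrite rowK.
by apply/memv_span/imageP; exists (enum_val j).
Qed.
End YoungBasis.

(** * Permutation characters as numbers of colourings *)

Section Colourings.
Local Notation row s i := (nth 0%N s i).
Variable q : nat.

(** Only the colours below [q] are used; [m] is a function on all natural numbers so
    that the row lengths of a diagram can be given directly. *)
Definition colourings n (m : nat -> nat) (g : 'S_n) : {set {ffun 'I_n -> 'I_q}} :=
  [set f : {ffun 'I_n -> 'I_q} |
    [forall c : 'I_q, #|[set k | f k == c]| == m c] && [forall k, f (g k) == f k]].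

Lemma colouringsP n (m : nat -> nat) (g : 'S_n) (f : {ffun 'I_n -> 'I_q}) :
  reflect ((forall c : 'I_q, #|[set k | f k == c]| = m c) /\ (forall k, f (g k) = f k))
          (f \in colourings m g).
Proof.
rewrite inE; apply: (iffP andP) => -[h1 h2]; split.
- by move=> c; apply/eqP/(forallP h1).
- by move=> k; apply/eqP/(forallP h2).
- by apply/forallP => c; apply/eqP.
by apply/forallP => k; apply/eqP.
Qed.

(** Rename the colours by [s]. *)
Lemma card_colourings_perm n (m m' : nat -> nat) (g : 'S_n) (s : 'S_q) :
  (forall c : 'I_q, m' c = m (s c)) -> #|colourings m' g| = #|colourings m g|.
Proof.
move=> ms; pose F (s : 'S_q) (f : {ffun 'I_n -> 'I_q}) := [ffun k => s (f k)].
have Finj s' : injective (F s').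
  move=> f f' /ffunP e; apply/ffunP => k; have := e k; rewrite !ffunE; exact: perm_inj.
rewrite -(card_imset _ (Finj s)); apply: eq_card => f; apply/imsetP/colouringsP.
  case=> f' /colouringsP[c1 c2] ->; split=> [c|k]; last by rewrite !ffunE c2.
  rewrite -(permKV s c) -ms -c1; apply: eq_card => k.
  by rewrite !inE ffunE (inj_eq perm_inj).
case=> c1 c2; exists (F s^-1%g f); last by apply/ffunP => k; rewrite !ffunE permKV.
apply/colouringsP; split=> [c|k]; last by rewrite !ffunE c2.
rewrite ms -c1; apply: eq_card => k; rewrite !inE ffunE.
by rewrite -(inj_eq (@perm_inj _ s)) permKV.
Qed.

Lemma fibers_perm n (f f' : 'I_n -> 'I_q) :
    (forall c, #|[set k | f k == c]| = #|[set k | f' k == c]|) ->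
  exists s : 'S_n, forall k, f k = f' (s k).
Proof.
move=> e; have/tuple_permP[s es] : perm_eq [tuple f k | k < n] [tuple f' k | k < n].
  have cnt (h : 'I_n -> 'I_q) c : count_mem c [tuple h k | k < n] = #|[set k | h k == c]|.
    rewrite /= count_map -size_filter cardE; apply: perm_size; apply: uniq_perm.
    - by rewrite filter_uniq // enum_uniq.
    - exact: enum_uniq.
    by move=> k; rewrite mem_filter !mem_enum andbT [RHS]inE.
  by apply/allP => c _; apply/eqP; rewrite !cnt e.
exists s => k; have := congr1 (fun t => nth (f k) t k) es.
rewrite -!tnth_nth !tnth_mktuple //.
Qed.

Section PiColourings.
Variables (n : nat) (lam : intpart n).
Hypothesis lamq : (size lam <= q)%N.

Let rq (k : 'I_n) : (cell_row lam k < q)%N.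
Proof. exact: leq_trans (cell_row_lt lam k) lamq. Qed.
Let F0 k := Ordinal (rq k).

Let F0c (c : 'I_q) : #|[set k | F0 k == c]| = row lam c.
Proof.
rewrite -(card_row_prefix (leqnn (row lam c))); apply: eq_card => k.
by rewrite !inE -val_eqE /=; case: eqP => //= <-; rewrite cell_col_lt.
Qed.

(** Cosets of the Young subgroup are the colourings [F0 \o y] obtained by moving
    the colouring [F0] of each cell number by its row. *)
Lemma Pi_char_colourings (g : 'S_n) :
  Pi_char lam g = #|colourings (nth 0%N lam) g|%:R.
Proof.
pose Y := young_subgroup lam.
have YP (s : 'S_n) : (s \in Y) = [forall k, F0 (s k) == F0 k].
  by rewrite inE; apply: eq_forallb => k; rewrite -val_eqE.
rewrite /Pi_char cfIndE ?subsetT //.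
pose fy (y : 'S_n) := [ffun k => F0 (y k)].
have inY y : (g ^ y \in Y)%g = (fy y \in colourings (nth 0%N lam) g).
  rewrite YP; apply/forallP/colouringsP => [h|[_ h] k].
    split=> [c|k].
      rewrite -F0c -(card_imset _ (@perm_inj _ y)); apply: eq_card => k; rewrite inE.
      apply/imsetP/idP => [[j] |]; first by rewrite inE ffunE => ? ->.
      by move=> e; exists ((y^-1)%g k); rewrite ?inE ?ffunE permKV.
    by rewrite !ffunE; have /eqP := h (y k); rewrite permJ.
  have := h ((y^-1)%g k); rewrite !ffunE permKV => /eqP.
  by rewrite -{3}(permKV y k) permJ.
transitivity (#|Y|%:R^-1 * #|[set y | fy y \in colourings (nth 0%N lam) g]|%:R : algC).
  congr (_ * _); rewrite -sum1_card natr_sum [RHS]big_mkcond /=.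
  apply: eq_big => [y|y _]; first by rewrite inE.
  by rewrite cfun1E -[_ \in young_set _]/(_ \in Y) inY [in RHS]inE; case: (_ \in _).
suff -> : #|[set y | fy y \in colourings (nth 0%N lam) g]| =
    (#|colourings (nth 0%N lam) g| * #|Y|)%N.
  by rewrite natrM mulrC mulfK // pnatr_eq0 -lt0n cardG_gt0.
rewrite -sum1_card (partition_big fy (mem (colourings (nth 0%N lam) g))) /=; last first.
  by move=> y; rewrite in_set.
rewrite (eq_bigr (fun=> #|Y|)) => [|f fc]; last first.
  have [y0 e0] : exists y0, f = fy y0.
    have [|s es] := @fibers_perm n f F0; last by exists s; apply/ffunP => k; rewrite ffunE es.
    by move=> c; rewrite F0c; case/colouringsP: fc.
  rewrite sum1_card -(card_lcoset _ y0); apply: eq_card => y; rewrite -[LHS]topredE /= in_set.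
  rewrite mem_lcoset -[_ \in young_set _]/(_ \in Y) YP; apply/andP/forallP => [[_ /eqP e] k|h].
    have /ffunP/(_ ((y0^-1)%g k)) : fy y = fy y0 by rewrite e.
    by rewrite !ffunE permKV permM => ->.
  have e : fy y = f.
    rewrite e0; apply/ffunP => k; have := h (y0 k).
    by rewrite !ffunE permM permK => /eqP.
  by rewrite e eqxx.
by rewrite sum_nat_const.
Qed.
End PiColourings.

Lemma card_colourings_lift n (m : nat -> nat) (g : 'S_n) :
  #|colourings m (lift_perm ord_max ord_max g)| =
  (\sum_(c < q | (0 < m c)%N) #|colourings (fun d => m d - (d == c)) g|)%N.
Proof.
pose rs (f : {ffun 'I_n.+1 -> 'I_q}) : {ffun 'I_n -> 'I_q} :=
  [ffun k : 'I_n => f (lift ord_max k)].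
pose ex (c : 'I_q) (f : {ffun 'I_n -> 'I_q}) : {ffun 'I_n.+1 -> 'I_q} :=
  [ffun k : 'I_n.+1 => if unlift ord_max k is Some j then f j else c].
have exK c : cancel (ex c) rs.
  by move=> f; apply/ffunP => k; rewrite !ffunE liftK.
have exm c f : ex c f ord_max = c by rewrite ffunE unlift_none.
have rsK (f : {ffun 'I_n.+1 -> 'I_q}) : ex (f ord_max) (rs f) = f.
  by apply/ffunP => k; rewrite !ffunE; case: unliftP => [j|] ->; rewrite ?ffunE.
have cnt (f : {ffun 'I_n.+1 -> 'I_q}) d :
    #|[set k | f k == d]| = ((f ord_max == d) + #|[set k | rs f k == d]|)%N.
  rewrite -!sum1_card !big_mkcond big_ord_recr /= addnC; congr (_ + _)%N.
    by rewrite inE; case: (_ == _).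
  rewrite [RHS]big_mkcond;  apply: eq_bigr => k _; rewrite !inE ffunE.
  by have -> : widen_ord (leqnSn n) k = lift ord_max k by apply: ord_inj; rewrite lift_max.
have inv (f : {ffun 'I_n.+1 -> 'I_q}) : (forall k, f (lift_perm ord_max ord_max g k) = f k) <->
    (forall k, rs f (g k) = rs f k).
  split=> h k; first by rewrite !ffunE -(lift_perm_lift ord_max ord_max) h.
  case: (unliftP ord_max k) => [j|] ->; last by rewrite lift_perm_id.
  by have := h j; rewrite !ffunE lift_perm_lift.
rewrite -sum1_card (partition_big (fun f : {ffun 'I_n.+1 -> 'I_q} => f ord_max)
  (fun c => (0 < m c)%N)) /=; last first.
  move=> f /colouringsP[h _]; rewrite -h cnt eqxx //.
apply: eq_bigr => c mc; rewrite sum1_card.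
have exinj : injective (ex c) by apply: can_inj (exK c).
rewrite -(card_imset _ exinj); apply: eq_card => f; rewrite -[LHS]topredE /=.
apply/andP/imsetP => [[/colouringsP[h1 h2] /eqP fc]|[f' /colouringsP[h1 h2] ->]].
  exists (rs f); last by rewrite -fc rsK.
  apply/colouringsP; split; last exact/inv.
  by move=> d; rewrite -h1 cnt fc eq_sym addKn.
rewrite exm eqxx; split=> //; apply/colouringsP; split; last by apply/inv; rewrite exK.
move=> d; rewrite cnt exm exK h1; have [<-|ne] := eqVneq c d; first by rewrite eqxx subnKC.
by move: ne; rewrite eq_sym -val_eqE /= => /negPf->; rewrite subn0.
Qed.
End Colourings.

Section Decrease.
Local Notation row s i := (nth 0%N s i).
Variables (n : nat) (lam : intpart n.+1).

Definition decrease k := [seq x <- set_nth 0%N lam k (row lam k).-1 | x != 0%N].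

Lemma perm_set_nth (s : seq nat) k v : (k < size s)%N ->
  perm_eq (row s k :: set_nth 0%N s k v) (v :: s).
Proof.
move=> ks; rewrite set_nthE ks -{4}(cat_take_drop k s) (drop_nth 0%N ks).
by apply/seq.permP => a /=; rewrite !count_cat /=; lia.
Qed.

(** Among the rows of the same length as row [k], let [j] be the last one. Removing a
    cell from row [j] leaves a diagram, with the same row lengths up to order as
    decreasing row [k]. *)
Lemma decrease_row k : (k < size lam)%N ->
  exists gam : intpart n, [/\ gam ≺ lam, perm_eq (decrease k) gam &
    exists j, row lam j = row lam k /\ adds_row j gam lam].
Proof.
move=> ks; have pl := intpartP lam; have lk : (0 < row lam k)%N by rewrite (is_part_gt0 k pl).
have exj : exists j, (k <= j)%N && (row lam j.+1 < row lam k)%N.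
  by exists (size lam); rewrite ltnW //= nth_default.
(* The least [j >= k] at which the rows get shorter than row [k]. *)
have [j /andP[kj jlt] jmin] := ex_minnP exj.
have ej : row lam j = row lam k.
  apply/eqP; rewrite eqn_leq (is_part_anti pl kj) /=.
  case: (ltngtP k j) kj => // [kj|->] _; last exact: leqnn.
  rewrite leqNgt; apply/negP => h; have := jmin j.-1.
  by rewrite -ltnS prednK ?h ?kj //= => [|//]; [move/(_ isT); lia | lia].
have js : (j < size lam)%N by rewrite -(is_part_gt0 j pl) ej.
have [gam a] : exists gam : intpart n, adds_row j gam lam by apply: remove_row_ex; rewrite ?ej.
exists gam; split; [by apply/adds_cellE; exists j | | by exists j].
have gE : gam = decrease j :> seq nat.
  have sg : forall i, row (set_nth 0%N lam j (row lam j).-1) i = row gam i.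
    by move=> i; rewrite nth_set_nth /=; have := a i; case: (eqVneq i j) => [->|] /=; lia.
  have ss : sorted geq (set_nth 0%N lam j (row lam j).-1).
    by apply/sorted_rowP => i; rewrite !sg; apply: is_part_anti (intpartP gam) (leqnSn i).
  apply: is_part_eq (intpartP gam) (strip_part ss) _ => i.
  by rewrite row_strip.
rewrite gE; apply: perm_filter; rewrite -(perm_cons (row lam k)).
rewrite (permPl (perm_set_nth _ ks)) -{1}ej perm_sym -{1}ej.
exact: perm_set_nth js.
Qed.

(** The coefficient counts the rows [k] for which [gam] is the diagram [g k] of
    [decrease_row]. *)
Lemma sum_coef (F : intpart n -> algC) :
  exists g : 'I_(size lam) -> intpart n,
    (forall k : 'I_(size lam), exists j, row lam j = row lam k /\ adds_row j (g k) lam) /\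
    \sum_(gam : intpart n | gam ≺ lam) (coef lam gam)%:R * F gam = \sum_k F (g k).
Proof.
have [g gP] := fin_all_exists (fun k : 'I_(size lam) => decrease_row (ltn_ord k)).
exists g; split; first by move=> k; case: (gP k).
have uniq_g (k : 'I_(size lam)) (gam : intpart n) : perm_eq (decrease k) gam = (gam == g k).
  have [_ pg _] := gP k; rewrite (permPl pg); apply/idP/eqP => [h|->]; last exact: perm_refl.
  apply/val_inj/esym/(@sorted_eq _ geq _ _ _ _ _ _ h).
  - by move=> x y z /= yx zy; apply: leq_trans zy yx.
  - by move=> x y /= xy; apply: anti_leq; rewrite andbC.
  - by case/and3P: (intpartP (g k)).
  by case/and3P: (intpartP gam).
transitivity (\sum_(gam : intpart n | gam ≺ lam) \sum_(k < size lam) (gam == g k)%:R * F gam).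
  apply: eq_bigr => gam _; rewrite -mulr_suml; congr (_ * _).
  rewrite /coef -sum1_card natr_sum big_mkcond; apply: eq_bigr => k _.
  by rewrite inE -/(decrease k) uniq_g; case: (_ == _).
rewrite exchange_big; apply: eq_bigr => k _ /=; rewrite (bigD1 (g k)) /=; last by case: (gP k).
rewrite eqxx mul1r big1 ?addr0 // => gam /andP[_ /negPf->]; exact: mul0r.
Qed.

(** Removing the last point takes one from the number of points of its colour [k].
    Exchanging the colours [k] and [j], which are equally frequent in [lam], gives
    the rows of [g k]. *)
Lemma Pi_char_lift (g : 'I_(size lam) -> intpart n) (s : 'S_n) :
    (forall k : 'I_(size lam), exists j, row lam j = row lam k /\ adds_row j (g k) lam) ->
  Pi_char lam (lift_perm ord_max ord_max s) = \sum_k Pi_char (g k) s.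
Proof.
move=> gP; have szl := is_part_size (intpartP lam).
rewrite (@Pi_char_colourings n.+1 _ _ szl) card_colourings_lift natr_sum.
have -> : \sum_(k < size lam) Pi_char (g k) s =
    \sum_(k < size lam) #|colourings n.+1 (fun d => row lam d - (d == k))%N s|%:R.
  apply: eq_bigr => k _; have [j [ej a]] := gP k.
  rewrite (@Pi_char_colourings n.+1); last exact: leqW (is_part_size (intpartP (g k))).
  have js : (j < n.+1)%N.
    apply: leq_trans szl; rewrite -(is_part_gt0 j (intpartP lam)) ej.
    by rewrite (is_part_gt0 k (intpartP lam)).
  have ks : (k < n.+1)%N by apply: leq_trans szl.
  congr (_%:R); apply/esym/(@card_colourings_perm _ _ _ _ _ (tperm (Ordinal ks) (Ordinal js))) => c.
  case: tpermP => [->|->|] /=.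
  - by have := a j; rewrite eqxx ej; lia.
  - have [e|ne] := eqVneq j k; first by move: (a k); rewrite e eqxx; lia.
    by have := a k; rewrite ej (negPf ne); lia.
  move=> /eqP; rewrite -val_eqE => /negPf /= -> /eqP; rewrite -val_eqE /= eq_sym => /negPf ne.
  by have := a c; rewrite ne; lia.
rewrite (big_ord_widen_cond _ (fun=> true)
  (fun k => #|colourings n.+1 (fun d => row lam d - (d == k))%N s|%:R : algC) szl) /=.
by apply: eq_bigl => k; rewrite (is_part_gt0 _ (intpartP lam)).
Qed.
End Decrease.

(** * The branching identity *)

Section Full.
Variable N : nat.

Lemma fixer_full : fixer N N = [set: 'S_N]%G.
Proof.
apply/val_inj/setP => g; rewrite /= in_setT; apply/fixerP => i.
by rewrite leqNgt ltn_ord.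
Qed.

(** The group [fixer N N] is the whole symmetric group, but not by conversion; the
    equality is used through a statement quantified over groups. *)
Lemma young_irrP (mu : intpart N) : has_young_basis mu 'Chi_(young_irr mu).
Proof.
apply: (@epsilon_spec _ (inhabits 0) (fun i => has_young_basis mu 'Chi_i)).
have : forall H : {group 'S_N}, fixer N N = H ->
    exists i : Iirr H, young_basis mu 'Chi_i.
  by move=> _ <-; exists (part_irr N mu); apply: young_basis_ex.
by move/(_ _ fixer_full).
Qed.

Lemma young_irr_part_irr (mu : intpart N) x : 'chi_(young_irr mu) x = 'chi_(part_irr N mu) x.
Proof.
have : forall H : {group 'S_N}, fixer N N = H -> forall i : Iirr H,
    young_basis mu 'Chi_i -> 'chi_i x = 'chi_(part_irr N mu) x.
  by move=> _ <- i /young_basis_uniq->.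
by move/(_ _ fixer_full); apply; apply: young_irrP.
Qed.

Lemma card_fixer k : (k <= N)%N -> #|fixer N k| = k`!.
Proof.
elim: k => [|k IHk] kN; first by rewrite fixer_le1 // cards1.
by rewrite (@card_fixer_succ N k (Ordinal kN)) // IHk ?(ltnW kN) // factS.
Qed.
End Full.

(** Frobenius reciprocity, with the branching rule for the induced character. *)
Lemma sum_branch n (H : {group 'S_n.+1}) (phi : 'CF(H)) (chi : intpart n.+1 -> Iirr H)
    (rho : intpart n) : fixer n.+1 n.+1 = H ->
    (forall mu x, 'chi_(chi mu) x = 'chi_(part_irr n.+1 mu) x) ->
  \sum_(mu : intpart n.+1 | rho ≺ mu) '[phi, 'chi_(chi mu)] =
  '['Res[fixer n.+1 n] phi, 'chi_(part_irr n.+1 rho)].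
Proof.
move=> HG; move: HG phi chi => <- phi chi chiE.
have {chiE} chiE mu : chi mu = part_irr n.+1 mu by apply/irr_inj/cfunP => x.
have [lev br] := labelled_branches (leqnn n.+1).
rewrite cfdotC Frobenius_reciprocity cfdotC conjCK.
rewrite cfdot_sum_irr sum_part_irr // [LHS]big_mkcond; apply: eq_bigr => mu _.
have -> : '['Ind[fixer n.+1 n.+1] 'chi_(part_irr n.+1 rho), 'chi_(part_irr n.+1 mu)] =
    (rho ≺ mu)%:R.
  rewrite -Frobenius_reciprocity cfdotC -[X in X^*]/(branch_mult _ _) br //.
  by rewrite conj_natr ?natr_nat.
by rewrite chiE conj_natr ?natr_nat //; case: (rho ≺ mu); rewrite (mulr1, mulr0).
Qed.

Section Embedding.
Variable n : nat.
Local Notation up := (lift_perm (@ord_max n) (@ord_max n)).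
Local Notation K := (fixer n.+1 n).

Lemma up_perm_inj : injective up.
Proof.
move=> s t e; apply/permP => i; apply: (@lift_inj _ ord_max).
by rewrite -!(lift_perm_lift ord_max ord_max) e.
Qed.

Lemma fixer_up : K = up @: [set: 'S_n] :> {set _}.
Proof.
apply/esym/eqP; rewrite eqEcard card_imset; last exact: up_perm_inj.
rewrite cardsT card_Sn card_fixer ?leqnSn // leqnn andbT.
apply/subsetP => g /imsetP[s _ ->]; apply/fixerP => i ni.
have -> : i = ord_max by apply: ord_inj; apply/eqP; rewrite eqn_leq ni -ltnS ltn_ord.
by rewrite lift_perm_id.
Qed.

Definition down (g : 'S_n.+1) : 'S_n := odflt 1%g [pick s | up s == g].

Lemma upK : cancel up down.
Proof.
move=> s; rewrite /down; case: pickP => [t /eqP/up_perm_inj //|/(_ s)].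
by rewrite eqxx.
Qed.

Lemma sum_fixer_up (f : 'S_n.+1 -> algC) : \sum_(g in K) f g = \sum_s f (up s).
Proof.
rewrite (eq_bigl (mem (up @: [set: 'S_n]))) => [|g]; last by rewrite fixer_up.
rewrite big_imset /=; last by move=> s t _ _; apply: up_perm_inj.
by apply: eq_bigl => s; rewrite in_setT.
Qed.

Section PullBack.
Variables (d : nat) (rG : mx_representation algC [set: 'S_n] d).

Lemma down_repr : mx_repr K (fun g => rG (down g)).
Proof.
split=> [|g h].
  by rewrite -(lift_perm1 ord_max) upK repr_mx1.
rewrite fixer_up => /imsetP[s _ ->] /imsetP[t _ ->].
by rewrite lift_permM !upK repr_mxM ?in_setT.
Qed.

(** The representation of the stabiliser of the last point of ['I_n.+1] that
    corresponds to [rG]. *)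
Definition pullback := MxRepresentation down_repr.

Lemma jm_pullback (i : 'I_n) : jm_mx pullback (lift ord_max i) = jucys_murphy rG i.
Proof.
rewrite /jm_mx /jucys_murphy big_mkcond big_ord_recr /= [RHS]big_mkcond.
have -> : (@ord_max n < lift ord_max i)%N = false by rewrite lift_max ltnNge /= ltnW.
rewrite addr0; apply: eq_bigr => j _.
have -> : widen_ord (leqnSn n) j = lift ord_max j by apply: ord_inj; rewrite lift_max.
have -> : bump n i = i by apply: (lift_max i).
 case: ifP => // ji; congr (rG _); rewrite -[RHS]upK; congr down.
apply/permP => k; case: (unliftP ord_max k) => [l|] ->.
  rewrite lift_perm_lift; case: (tpermP j i l) => [->|->|/eqP lj /eqP li].
  - by rewrite tpermL.
  - by rewrite tpermR.
  by rewrite tpermD // (inj_eq (@lift_inj _ _)) eq_sym.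
by rewrite lift_perm_id tpermD // eq_sym neq_lift.
Qed.
End PullBack.

(** The labels of the two ambient groups agree: a Young basis for ['S_n] is also one
    for the pullback, as the Jucys-Murphy elements correspond. *)
Lemma part_irr_up (rho : intpart n) (s : 'S_n) :
  'chi_(part_irr n.+1 rho) (up s) = 'chi_(young_irr rho) s.
Proof.
set i := young_irr rho; pose rG := pullback 'Chi_i.
have chiE t : cfRepr rG (up t) = 'chi_i t.
  have uK : up t \in K by rewrite /= fixer_up imset_f ?in_setT.
  by rewrite cfunE uK mulr1n /= upK -irrRepr cfunE in_setT mulr1n.
have /irrP[j jE] : cfRepr rG \in irr K.
  rewrite irrEchar cfRepr_char cfdotE card_fixer ?leqnSn // sum_fixer_up.
  have := cfnorm_irr i; rewrite cfdotE cardsT card_Sn => e; apply/eqP.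
  rewrite -[RHS]e; congr (_ * _); rewrite [RHS](eq_bigl xpredT) => [|t]; last by rewrite in_setT.
  by apply: eq_bigr => t _; rewrite chiE.
suff e : j = part_irr n.+1 rho by rewrite -e -jE chiE.
have [v [vb vjm]] := young_irrP rho.
have [|T T0] := young_basis_syt 'Chi_i _ vb; first exact: irr_degree_gt0.
have [c [hc cN _ cE]] := syt_chain_ex (valP T).
have vE : v T *m isoproj rG (rows_irr n.+1 n (c n)) = v T.
  apply: joint_eigenvector => // x xn.
  have -> : x = lift ord_max (Ordinal xn) by apply: ord_inj; rewrite lift_max.
  by rewrite jm_pullback vjm lift_max -intrB cE.
apply/eqP; apply: contraNT T0 => ne; rewrite -vE cN rows_irrE.
have /eqP -> : isoproj rG (part_irr n.+1 rho) == 0; last by rewrite mulmx0.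
by rewrite isoproj_eq0 // cfRes_id jE cfdot_irr (negPf ne).
Qed.

Lemma cfdot_Res_up (phi : 'CF([set: 'S_n.+1])) (rho : intpart n) :
  '['Res[K] phi, 'chi_(part_irr n.+1 rho)] =
  #|[set: 'S_n]|%:R^-1 * \sum_s phi (up s) * ('chi_(young_irr rho) s)^*.
Proof.
rewrite cfdotE card_fixer ?leqnSn // cardsT card_Sn sum_fixer_up; congr (_ * _).
apply: eq_bigr => s _; rewrite part_irr_up cfResE ?subsetT //.
by rewrite /= fixer_up imset_f ?in_setT.
Qed.
End Embedding.

Theorem theorem3 (n : nat) (lam : intpart n.+1) (rho : intpart n) :
  \sum_(mu : intpart n.+1 | rho ≺ mu) mult mu lam =
  \sum_(gam : intpart n | gam ≺ lam) (coef lam gam)%:R * mult rho gam.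
Proof.
have [g [gP ->]] := sum_coef lam (mult rho).
rewrite (@sum_branch n [set: _]%G (Pi_char lam) (@young_irr _) rho (fixer_full _)); last first.
  by move=> mu x; apply: young_irr_part_irr.
rewrite cfdot_Res_up.
under eq_bigr => s _ do rewrite (Pi_char_lift _ gP) mulr_suml.
rewrite exchange_big mulr_sumr; apply: eq_bigr => k _ /=; rewrite /mult cfdotE.
by congr (_ * _); apply: eq_bigl => s; rewrite in_setT.
Qed.
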